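(* Let $k$ be an algebraically closed field, $n\ge2$, $G=\mathrm{GL}_n(k)$, $\mathfrak g=\mathfrak{gl}_n(k)$, and $k[\mathfrak g]=k[\xi_{ij}:1\le i,j\le n]$ the polynomial functions on $\mathfrak g$, where $\xi_{ij}$ is the $(i,j)$-entry function. Let $t\in\{1,\dots,n-1\}$, put $\lambda^t=(t,0,\dots,0,-1,\dots,-1)$ (with $t$ entries $-1$) and $\mu^t=(1,\dots,1,0,\dots,0,-t)$ (with $t$ entries $1$), and for $I\subseteq\{2,\dots,n\}$ with $|I|=t$ define $$u_{t,I}=\det\big((\partial_{1i}s_j)_{n-t+1\le i\le n,\ j\in I}\big),\qquad v_{t,I}=\det\big((\partial_{in}s_j)_{1\le i\le t,\ j\in I}\big),$$ where the indices in $I$ are taken in increasing order. Then: (i) The elements $u_{t,I}$, $I\subseteq\{2,\dots,n\}$ with $|I|=t$, form a basis of the $k[\mathfrak g]^G$-module $k[\mathfrak g]^U_{\lambda^t}$; likewise the $v_{t,I}$ form a basis of the $k[\mathfrak g]^G$-module $k[\mathfrak g]^U_{\mu^t}$. (ii) Every nontrivial $k$-linear combination of the $u_{t,I}$ ($I\subseteq\{2,\dots,n\}$, $|I|=t$) is an irreducible element of $k[\mathfrak g]$ and a $B$-semi-invariant of weight $\lambda^t$; likewise every nontrivial $k$-linear combination of the $v_{t,I}$ is irreducible and a $B$-semi-invariant of weight $\mu^t$.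
   Context: $G$ acts on $\mathfrak g$ by conjugation and on $k[\mathfrak g]$ by $(g\cdot f)(x)=f(g^{-1}xg)$. $U$ is the subgroup of upper unitriangular matrices, $B$ the subgroup of invertible upper triangular matrices, $T$ the diagonal torus; $(\lambda_1,\dots,\lambda_n)\in\mathbb Z^n$ denotes the character $\mathrm{diag}(a_1,\dots,a_n)\mapsto\prod a_i^{\lambda_i}$ of $T$, extended to $B$ via $B\to T$. $k[\mathfrak g]^U_\lambda$ is the space of $U$-invariant polynomials of $T$-weight $\lambda$; it is a module over the invariant algebra $k[\mathfrak g]^G$. A $B$-semi-invariant of weight $\lambda$ is an $f$ with $b\cdot f=\lambda(b)f$ for all $b\in B$. $s_i\in k[\mathfrak g]$ ($1\le i\le n$) is defined by $s_i(x)=\mathrm{tr}(\wedge^i x)$, and $\partial_{ij}=\partial/\partial\xi_{ij}$. *)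

(* Defs.v *)
From HB Require Import structures.
From mathcomp Require Import all_boot all_order all_algebra.
From mathcomp Require Import mpoly.
Set Implicit Arguments. Unset Strict Implicit. Unset Printing Implicit Defensive.
Import Order.TTheory GRing.Theory Num.Theory.
Local Open Scope ring_scope.

Section GLn.
Variables (k : fieldType) (n : nat).

(* k[g] = k[xi_ij : i, j < n]; indices are 0-based. *)
Notation kg := {mpoly k[n * n]}.

Definition xi (i j : 'I_n) : kg := 'X_(mxvec_index i j).

Definition genmx : 'M[kg]_n := \matrix_(i, j) xi i j.

(* (g . f)(x) = f(g^-1 x g) : substitute xi_ij := (g^-1 X g)_ij *)
Definition act (g : 'M[k]_n) (f : kg) : kg :=
  let M := map_mx (fun c => c%:MP) (invmx g) *m genmx *m map_mx (fun c => c%:MP) g in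
  f \mPo [tuple (mxvec M) 0 m | m < n * n].

Definition in_G (g : 'M[k]_n) : bool := g \in unitmx.
Definition in_B (g : 'M[k]_n) : Prop :=
  g \in unitmx /\ forall i j : 'I_n, (j < i)%N -> g i j = 0.
Definition in_U (g : 'M[k]_n) : Prop :=
  (forall i : 'I_n, g i i = 1) /\ forall i j : 'I_n, (j < i)%N -> g i j = 0.
Definition in_T (g : 'M[k]_n) : Prop :=
  g \in unitmx /\ forall i j : 'I_n, i != j -> g i j = 0.

(* the character lambda of T (extended to B via B -> T) *)
Definition chr (lam : 'I_n -> int) (g : 'M[k]_n) : k := \prod_i (g i i) ^ (lam i).

Definition G_inv (f : kg) : Prop := forall g, in_G g -> act g f = f.
Definition U_inv_wt (lam : 'I_n -> int) (f : kg) : Prop :=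
  (forall u, in_U u -> act u f = f) /\
  (forall t, in_T t -> act t f = chr lam t *: f).
Definition B_semi_inv (lam : 'I_n -> int) (f : kg) : Prop :=
  forall b, in_B b -> act b f = chr lam b *: f.

(* s_i = tr(wedge^i x) = sum of the principal i x i minors of x *)
Definition s (i : nat) : kg :=
  \sum_(S : {set 'I_n} | #|S| == i)
     \det (mxsub (@enum_val _ (mem S)) (@enum_val _ (mem S)) genmx).

Definition dxi (i j : 'I_n) (f : kg) : kg := mderiv (mxvec_index i j) f.

(* the natural number m as an element of 'I_n (only used with m < n;
   d is an irrelevant default) *)
Definition nat_ord (d : 'I_n) (m : nat) : 'I_n := insubd d m.

(* u_{t,I} with t = #|I|: rows i = n-t+1..n (1-based), columns j in I increasing.
   A 0-based index j : 'I_n stands for the paper's j+1, so s_j is s (j+1). *)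
Definition u_ (I : {set 'I_n}) : kg :=
  \det (\matrix_(a < #|I|, b < #|I|)
          let j := enum_val b in
          dxi (nat_ord j 0) (nat_ord j (n - #|I| + a)) (s j.+1)).

Definition v_ (I : {set 'I_n}) : kg :=
  \det (\matrix_(a < #|I|, b < #|I|)
          let j := enum_val b in
          dxi (nat_ord j a) (nat_ord j n.-1) (s j.+1)).

Definition lam_ (t : nat) (i : 'I_n) : int :=
  if i == 0 :> nat then t%:Z else if (n - t <= i)%N then -1 else 0.
Definition mu_ (t : nat) (i : 'I_n) : int :=
  if (i < t)%N then 1 else if i == n.-1 :> nat then - t%:Z else 0.

(* index set: I subset {2..n} (1-based), i.e. 0 \notin I, with |I| = t *)
Definition Iadm (t : nat) (I : {set 'I_n}) : bool :=
  [forall i in I, 0 < i]%N && (#|I| == t).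

End GLn.

Definition module_basis (R : comNzRingType) (J : finType)
    (A M : R -> Prop) (P : pred J) (e : J -> R) : Prop :=
  [/\ forall j, P j -> M (e j),
      forall f, M f -> exists c : J -> R,
          (forall j, A (c j)) /\ f = \sum_(j | P j) c j * e j
    & forall c : J -> R, (forall j, A (c j)) ->
          \sum_(j | P j) c j * e j = 0 -> forall j, P j -> c j = 0].

Definition irreducible_elt (R : idomainType) (f : R) : Prop :=
  [/\ f != 0, f \isn't a GRing.unit &
      forall a b, f = a * b -> a \is a GRing.unit \/ b \is a GRing.unit].

(* Main.v *)
Require Import Defs.
From HB Require Import structures.
From mathcomp Require Import all_boot all_order all_algebra.
From mathcomp Require Import fingroup perm mpoly.
From mathcomp Require Import zify ring.
Set Implicit Arguments. Unset Strict Implicit. Unset Printing Implicit Defensive.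
Import Order.TTheory GRing.Theory Num.Theory.
Local Open Scope ring_scope.

(* Let H(x) be the matrix whose j-th column is the vector b_j with entries
   (d_{1i} s_j)(x).  Since adj(1 + zx)(1 + zx) = sum_j s_j(x) z^j, these columns satisfy
   b_1 = e_1 and x b_j = s_j(x) e_1 - b_{j+1}; so if H(x) is invertible then
   x = H(x) C H(x)^-1 with C a companion matrix depending only on the s_j(x),
   and u_{t,I} is the minor of H with the last t rows and the columns in I.

   For a highest weight vector f and a < b, the functions of c and d given by the
   lower root subgroup and by the big cell are polynomial and glued by
   d = 1/c.  Hence f = 0 unless lambda_a >= lambda_b, f is invariant under the
   lower root subgroup if the weights are equal, and is moved by a multiple of
   the reflected vector if they differ by 1.  As lambda^t takes only the values
   0 and -1 away from the first index, a highest weight vector of weight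
   lambda^t vanishing at all conjugates of C by permutations fixing 1 vanishes
   on the whole orbit of C under the stabiliser of e_1.  Evaluation at one
   permutation per subset I thus determines f, and the u_{t,I} are dual
   to these evaluations: this gives the module basis.

   If f = ab is a combination of the u_{t,I}, then a and b are again highest
   weight vectors, by degree considerations in one-parameter subgroups.
   Their weights are dominant with sum of entries 0, and their last entries are
   nonpositive and add up to -1; so one of the weights is 0, the
   corresponding factor is G-invariant, and freeness makes it a scalar.  The
   statements on the v_{t,I} follow by transposition along the antidiagonal. *)

(** * Polynomials over an infinite field are determined by their values *)

Lemma base_expansion_inj (D n : nat) (a b : nat -> nat) :
  (forall i, i < n -> a i < D)%N -> (forall i, i < n -> b i < D)%N ->
  (\sum_(i < n) a i * D ^ i = \sum_(i < n) b i * D ^ i)%N ->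
  forall i, (i < n)%N -> a i = b i.
Proof.
elim: n a b => [//|n IH] a b ha hb; rewrite !big_ord_recl /= !expn0 !muln1.
have E c : (\sum_(i < n) c (bump 0 i) * D ^ bump 0 i
            = (\sum_(i < n) c i.+1 * D ^ i) * D)%N.
  by rewrite big_distrl; apply: eq_bigr => i _; rewrite /bump /= add1n expnSr mulnA.
rewrite !E => e.
have a0 := ha 0%N isT; have b0 := hb 0%N isT.
have e0 : a 0%N = b 0%N.
  by have := congr1 (modn ^~ D) e; rewrite /= ![(_ + _ * D)%N]addnC !modnMDl !modn_small.
move: e; rewrite e0 => /addnI /eqP; rewrite eqn_pmul2r ?(leq_ltn_trans _ b0) //.
move=> /eqP /(IH (a \o S) (b \o S)) IHe [|i] //; rewrite ltnS => hi.
by apply: IHe => // j hj; [apply: ha | apply: hb].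
Qed.

Section InfiniteField.
Variable k : closedFieldType.

Lemma closed_field_avoid (s : seq k) : exists x, x \notin s.
Proof.
have /closed_nonrootP [x] : \prod_(y <- s) ('X - y%:P) != 0.
  by rewrite monic_neq0 // monic_prod_XsubC.
by rewrite root_prod_XsubC; exists x.
Qed.

Lemma closed_field_uniq (N : nat) :
  exists s : seq k, [/\ size s = N, uniq s & 0 \notin s].
Proof.
elim: N => [|N [s [sN us s0]]]; first by exists [::].
have [x] := closed_field_avoid (0 :: s); rewrite inE negb_or => /andP[x0 xs].
by exists (x :: s); rewrite /= sN xs us inE negb_or eq_sym x0 s0.
Qed.

(** The nonzero scalars are infinitely many and stay distinct in [K], so [P] has more roots than its
    degree allows. With [K] the ring k[g], identities in a parameter c need only be checked at
    nonzero scalars c. *)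
Lemma poly_eq0_nonzero_points (K : idomainType) (i : {rmorphism k -> K}) (P : {poly K}) :
  (forall c, c != 0 -> P.[i c] = 0) -> P = 0.
Proof.
move=> hP; have [s [sN us s0]] := closed_field_uniq (size P).
apply: (@roots_geq_poly_eq0 _ _ (map i s)).
- apply/allP => _ /mapP[c cs ->]; apply/eqP/hP.
  by apply: contraNneq s0 => <-.
- by rewrite map_inj_uniq //; apply: fmorph_inj.
- by rewrite size_map sN.
Qed.

Lemma poly_eq_nonzero_points (K : idomainType) (i : {rmorphism k -> K}) (P Q : {poly K}) :
  (forall c, c != 0 -> P.[i c] = Q.[i c]) -> P = Q.
Proof.
move=> hPQ; apply/eqP; rewrite -subr_eq0; apply/eqP.
apply: (poly_eq0_nonzero_points (i := i)) => c c0.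
by rewrite hornerD hornerN hPQ // subrr.
Qed.

(* Kronecker substitution X_i := X^(D^i), with D exceeding every exponent of f. *)
Lemma mpoly_eq0_points (N : nat) (f : {mpoly k[N]}) :
  (forall v : 'I_N -> k, f.@[v] = 0) -> f = 0.
Proof.
move=> hf; apply/eqP; case: eqP => // /eqP f0.
pose D := msize f; pose kr (m : 'X_{1..N}) := (\sum_(i < N) m i * D ^ i)%N.
pose P : {poly k} := \sum_(m <- msupp f) f@_m *: 'X^(kr m).
have P0 : P = 0.
  apply: (poly_eq0_nonzero_points (i := idfun)) => c _ /=.
  rewrite -(hf (fun i => c ^+ (D ^ i))) mevalE /P horner_sum.
  apply: eq_bigr => m _; rewrite hornerZ hornerXn; congr (_ * _).
  rewrite /kr expr_sum; apply: eq_bigr => i _.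
  by rewrite -exprM mulnC.
(* The exponents of m are the base [D] digits of [kr m], so no other monomial of [f] contributes to
   this coefficient of [P], which is the leading coefficient of [f]. *)
have /eqP := congr1 (fun Q : {poly k} => Q`_(kr (mlead f))) P0.
rewrite coef0 /P coef_sum (bigD1_seq (mlead f)) ?msupp_uniq ?mlead_supp //=.
rewrite coefZ coefXn eqxx mulr1 big_seq_cond big1 ?addr0 ?mleadc_eq0 ?(negPf f0) //.
move=> m /andP[mf mne]; rewrite coefZ coefXn; case: eqP => [e|]; last by rewrite mulr0.
case/negP: mne; apply/eqP/mnmP => i.
have bnd (m' : 'X_{1..N}) : m' \in msupp f ->
    forall j, (j < N -> oapp (fun i => m' i) 0%N (insub j) < D)%N.
  move=> m'f j hj; rewrite insubT /=.
  apply: leq_ltn_trans (msize_mdeg_lt m'f).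
  by rewrite mdegE (bigD1 (Ordinal hj)) //= leq_addr.
have := base_expansion_inj (bnd _ mf) (bnd _ (mlead_supp f0)).
move=> /(_ _ i (ltn_ord i)); rewrite !valK /=; apply.
under eq_bigr do rewrite valK /=.
by under [RHS]eq_bigr do rewrite valK /=.
Qed.

Lemma mpoly_eq_points (N : nat) (f g : {mpoly k[N]}) :
  (forall v : 'I_N -> k, f.@[v] = g.@[v]) -> f = g.
Proof.
move=> hfg; apply/eqP; rewrite -subr_eq0; apply/eqP/mpoly_eq0_points => v.
by rewrite mevalB hfg subrr.
Qed.

End InfiniteField.

(** * Evaluation, substitution and the conjugation action on k[g] *)

HB.lock Definition ev (k : fieldType) (n : nat) (x : 'M[k]_n) (f : {mpoly k[n * n]}) : k :=
  f.@[mxvec x 0].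

HB.lock Definition pull (k : fieldType) (n : nat) (M : 'M[{mpoly k[n * n]}]_n)
    (f : {mpoly k[n * n]}) : {mpoly k[n * n]} :=
  f \mPo [tuple mxvec M 0 m | m < n * n].

(* Locked copy of [act]: unification must not unfold the substitution. *)
HB.lock Definition gact (k : fieldType) (n : nat) (g : 'M[k]_n)
    (f : {mpoly k[n * n]}) : {mpoly k[n * n]} := act g f.

Section Action.
Variables (k : closedFieldType) (n : nat).
Local Notation kg := {mpoly k[n * n]}.
Implicit Types (f : kg) (g h x y : 'M[k]_n) (lam : 'I_n -> int).


Lemma ev_is_rmorphism x : monoid_morphism (ev x).
Proof. by rewrite ev.unlock; split; [exact: meval1 | exact: mevalM]. Qed.

Lemma ev_is_linear x : linear_for *%R (ev x).
Proof. by rewrite ev.unlock => c p q; rewrite mevalD mevalZ. Qed.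

HB.instance Definition _ x :=
  GRing.isLinear.Build k kg k *%R (ev x) (ev_is_linear x).
HB.instance Definition _ x :=
  GRing.isMonoidMorphism.Build kg k (ev x) (ev_is_rmorphism x).

Lemma evC x c : ev x c%:MP = c.
Proof. by rewrite ev.unlock mevalC. Qed.

(** As [k] is infinite, matrices separate polynomials; identities in k[g] thereby become identities
    between matrices. *)
Lemma ev_inj f1 f2 : (forall x, ev x f1 = ev x f2) -> f1 = f2.
Proof.
move=> e; apply: mpoly_eq_points => v.
have := e (vec_mx (\row_m v m)); rewrite ev.unlock vec_mxK.
have E : (\row_m v m : 'rV_(n * n)) 0 =1 v by move=> m; rewrite mxE.
by rewrite !(meval_eq _ E).
Qed.

Lemma pull_is_rmorphism (M : 'M[kg]_n) : monoid_morphism (pull M).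
Proof.
by rewrite pull.unlock; split; [exact: comp_mpoly1 | exact: rmorphM].
Qed.

Lemma pull_is_linear (M : 'M[kg]_n) : linear (pull M).
Proof. by rewrite pull.unlock => c p q; rewrite linearP. Qed.

HB.instance Definition _ (M : 'M[kg]_n) :=
  GRing.isLinear.Build k kg kg *:%R (pull M) (pull_is_linear M).
HB.instance Definition _ (M : 'M[kg]_n) :=
  GRing.isMonoidMorphism.Build kg kg (pull M) (pull_is_rmorphism M).

Lemma ev_pull y (M : 'M[kg]_n) f : ev y (pull M f) = ev (map_mx (ev y) M) f.
Proof.
rewrite pull.unlock ev.unlock comp_mpoly_meval; apply: meval_eq => m.
by rewrite tnth_mktuple -map_mxvec mxE.
Qed.

Lemma ev_xi x i j : ev x (xi k i j) = x i j.
Proof. by rewrite ev.unlock mevalXU mxvecE. Qed.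

Lemma map_ev_genmx x : map_mx (ev x) (Defs.genmx k n) = x.
Proof. by apply/matrixP => i j; rewrite !mxE ev_xi. Qed.

Lemma map_evC x (g : 'M[k]_n) : map_mx (ev x) (map_mx (fun c => c%:MP) g) = g.
Proof. by apply/matrixP => i j; rewrite !mxE evC. Qed.

Definition actmx g : 'M[kg]_n :=
  map_mx (fun c => c%:MP) (invmx g) *m Defs.genmx k n *m map_mx (fun c => c%:MP) g.

Lemma act_gact g f : act g f = gact g f.
Proof. by rewrite gact.unlock. Qed.

Lemma gactE g : gact g = pull (actmx g).
Proof. by rewrite gact.unlock pull.unlock. Qed.

Lemma ev_act x g f : ev x (gact g f) = ev (invmx g *m x *m g) f.
Proof. by rewrite gactE ev_pull !map_mxM map_ev_genmx !map_evC. Qed.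

HB.instance Definition _ g :=
  GRing.isLinear.Build k kg kg *:%R (gact g)
    (eq_rect_r (fun F => linear F) (pull_is_linear (actmx g)) (gactE g)).
HB.instance Definition _ g :=
  GRing.isMonoidMorphism.Build kg kg (gact g)
    (eq_rect_r (fun F => monoid_morphism F) (pull_is_rmorphism (actmx g)) (gactE g)).

Lemma act1 f : gact 1%:M f = f.
Proof. by apply: ev_inj => x; rewrite ev_act invmx1 mul1mx mulmx1. Qed.

Lemma invmx_eq g h : h *m g = 1%:M -> invmx g = h.
Proof.
move=> hg; have [_ ug] := mulmx1_unit hg.
by rewrite -[RHS](mulmxK ug) hg mul1mx.
Qed.

Lemma invmxM g h : g \in unitmx -> h \in unitmx ->
  invmx (g *m h) = invmx h *m invmx g.
Proof.
move=> ug uh; apply: invmx_eq.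
by rewrite -mulmxA (mulmxA (invmx g)) mulVmx // mul1mx mulVmx.
Qed.

Lemma actM g h f : g \in unitmx -> h \in unitmx ->
  gact (g *m h) f = gact g (gact h f).
Proof.
move=> ug uh; apply: ev_inj => x.
rewrite (ev_act x (g *m h)) (ev_act x g) (ev_act _ h) (invmxM ug uh).
by rewrite !mulmxA.
Qed.

Lemma actC g c : gact g c%:MP = c%:MP.
Proof. by apply: ev_inj => x; rewrite ev_act !evC. Qed.

Definition transv (i j : 'I_n) (c : k) : 'M[k]_n := 1%:M + c *: delta_mx i j.

Lemma transv0 i j : transv i j 0 = 1%:M.
Proof. by rewrite /transv scale0r addr0. Qed.

Lemma transvD i j c d : i != j -> transv i j c *m transv i j d = transv i j (c + d).
Proof.
move=> ij; rewrite /transv mulmxDl !mulmxDr mul1mx !mulmx1 mul1mx.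
rewrite -scalemxAl -scalemxAr mul_delta_mx_0 1?eq_sym // !scaler0 addr0.
by rewrite -addrA -scalerDl addrC [d + c]addrC addrC.
Qed.

Lemma transvN i j c : i != j -> transv i j c *m transv i j (- c) = 1%:M.
Proof. by move=> ij; rewrite transvD // subrr transv0. Qed.

Lemma transv_unit i j c : i != j -> transv i j c \in unitmx.
Proof. by move=> ij; have [] := mulmx1_unit (transvN c ij). Qed.

Lemma inv_transv i j c : i != j -> invmx (transv i j c) = transv i j (- c).
Proof. by move=> ij; apply: invmx_eq; rewrite transvD // addNr transv0. Qed.

Lemma transvE i j c a b :
  transv i j c a b = (a == b)%:R + c * ((a == i) && (b == j))%:R.
Proof. by rewrite !mxE. Qed.

Lemma transv_in_U (i j : 'I_n) c : (i < j)%N -> in_U (transv i j c).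
Proof.
move=> ij; split=> [a|a b ba]; rewrite transvE.
  rewrite eqxx; case: eqP => [->|] /=; last by rewrite mulr0 addr0.
  by rewrite (negPf (_ : i != j)) ?mulr0 ?addr0 // neq_ltn ij.
rewrite -(inj_eq val_inj) /= gtn_eqF // add0r; case: eqP => [ai|_] /=; last by rewrite mulr0.
case: eqP => [bj|_]; last by rewrite mulr0.
by move: ba; rewrite ai bj ltnNge (ltnW ij).
Qed.

Lemma upper_det g : (forall i j : 'I_n, (j < i)%N -> g i j = 0) ->
  \det g = \prod_i g i i.
Proof.
move=> hg; rewrite -det_tr det_trig; first by apply: eq_bigr => i _; rewrite mxE.
by apply/is_trig_mxP => i j ij; rewrite mxE hg.
Qed.

Lemma in_U_det g : in_U g -> \det g = 1.
Proof. by case=> g1 g0; rewrite upper_det // big1. Qed.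

Lemma in_U_in_B g : in_U g -> in_B g.
Proof. by move=> gU; split; [rewrite unitmxE in_U_det // unitr1 | case: gU]. Qed.

Lemma in_T_in_B g : in_T g -> in_B g.
Proof. by case=> gu g0; split=> // i j ji; rewrite g0 // neq_ltn ji orbT. Qed.

Lemma in_B_diag g : in_B g -> forall i, g i i != 0.
Proof.
by case=> gu g0 i; move: gu; rewrite unitmxE upper_det // unitfE prodf_seq_neq0 => /allP/(_ i (mem_index_enum _)).
Qed.

Lemma chr_in_U lam g : in_U g -> chr lam g = 1.
Proof. by case=> g1 _; rewrite /chr big1 // => i _; rewrite g1 exp1rz. Qed.

Lemma chr_neq0 lam g : in_B g -> chr lam g != 0.
Proof.
move=> gB; rewrite /chr prodf_seq_neq0; apply/allP => i _ /=.
by rewrite expfz_neq0 // in_B_diag.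
Qed.

Lemma diag_in_T (d : 'rV[k]_n) : (forall i, d 0 i != 0) -> in_T (diag_mx d).
Proof.
move=> d0; split; last by move=> i j ij; rewrite mxE (negPf ij).
rewrite unitmxE det_diag unitfE prodf_seq_neq0; apply/allP => i _ /=; exact: d0.
Qed.

(** An element of B is its diagonal part times a unitriangular matrix, and [chr] sees only the
    diagonal. *)
Lemma B_semi_invE lam f : B_semi_inv lam f <-> U_inv_wt lam f.
Proof.
split=> [fB|[fU fT]].
  split=> g hg; last by rewrite fB //; apply: in_T_in_B.
  by rewrite fB ?chr_in_U ?scale1r //; apply: in_U_in_B.
move=> g gB; pose d : 'rV[k]_n := \row_i g i i.
have d0 i : d 0 i != 0 by rewrite mxE in_B_diag.
have dT := diag_in_T d0; pose u := diag_mx (\row_i (d 0 i)^-1) *m g.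
have ue i j : u i j = (g i i)^-1 * g i j by rewrite /u mul_diag_mx !mxE.
have uU : in_U u.
  split=> [i|i j ji]; rewrite ue; first by rewrite mulVf // in_B_diag.
  by rewrite (proj2 gB i j ji) mulr0.
have -> : g = diag_mx d *m u.
  by apply/matrixP => i j; rewrite mul_diag_mx mxE ue mxE mulrA mulfV ?mul1r ?in_B_diag.
rewrite act_gact actM; [|by case: dT|by case: (in_U_in_B uU)].
rewrite -[gact u f]act_gact fU // -act_gact fT //; congr (_ *: _); apply: eq_bigr => i _; congr (_ ^ _).
by rewrite mul_diag_mx [in RHS]mxE [u _ _](proj1 uU) mulr1 mxE eqxx mulr1n.
Qed.

End Action.

(** * Polynomial and Laurent dependence on a parameter *)

Section FunctionRings.
Variables (I : Type) (K : comNzRingType).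

(** The instances are the functions of a scalar c that are polynomial, respectively Laurent, in c;
    determinants, adjugates and the action are treated once for both. The field [fr_ext] stands in
    for functional extensionality. *)
Record function_ring (Q : (I -> K) -> Prop) : Prop := FunctionRing {
  fr_ext : forall h1 h2, h1 =1 h2 -> Q h1 -> Q h2;
  fr_cst : forall a, Q (fun=> a);
  fr_add : forall h1 h2, Q h1 -> Q h2 -> Q (fun c => h1 c + h2 c);
  fr_mul : forall h1 h2, Q h1 -> Q h2 -> Q (fun c => h1 c * h2 c) }.

Variables (Q : (I -> K) -> Prop) (QR : function_ring Q).

Lemma fr_sum (J : Type) (r : seq J) (P : pred J) (F : J -> I -> K) :
  (forall j, Q (F j)) -> Q (fun c => \sum_(j <- r | P j) F j c).
Proof.
move=> QF; elim: r => [|j r IH].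
  by apply: (fr_ext QR _ (fr_cst QR 0)) => c; rewrite big_nil.
case Pj: (P j); last by apply: (fr_ext QR _ IH) => c; rewrite big_cons Pj.
by apply: (fr_ext QR _ (fr_add QR (QF j) IH)) => c; rewrite big_cons Pj.
Qed.

Lemma fr_prod (J : Type) (r : seq J) (P : pred J) (F : J -> I -> K) :
  (forall j, Q (F j)) -> Q (fun c => \prod_(j <- r | P j) F j c).
Proof.
move=> QF; elim: r => [|j r IH].
  by apply: (fr_ext QR _ (fr_cst QR 1)) => c; rewrite big_nil.
case Pj: (P j); last by apply: (fr_ext QR _ IH) => c; rewrite big_cons Pj.
by apply: (fr_ext QR _ (fr_mul QR (QF j) IH)) => c; rewrite big_cons Pj.
Qed.

Lemma fr_exp (h : I -> K) m : Q h -> Q (fun c => h c ^+ m).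
Proof.
move=> Qh; elim: m => [|m IH]; first exact: fr_cst.
by apply: (fr_ext QR _ (fr_mul QR Qh IH)) => c; rewrite exprS.
Qed.

Lemma fr_mulmx m p q (A : I -> 'M[K]_(m, p)) (B : I -> 'M[K]_(p, q)) :
  (forall i j, Q (fun c => A c i j)) -> (forall i j, Q (fun c => B c i j)) ->
  forall i j, Q (fun c => (A c *m B c) i j).
Proof.
move=> QA QB i j; apply: (fr_ext QR (h1 := fun c => \sum_l A c i l * B c l j)).
  by move=> c; rewrite mxE.
by apply: fr_sum => l; apply: (fr_mul QR).
Qed.

Lemma fr_det m (A : I -> 'M[K]_m) :
  (forall i j, Q (fun c => A c i j)) -> Q (fun c => \det (A c)).
Proof.
move=> QA; apply: fr_sum => s; apply: (fr_mul QR); first exact: fr_cst.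
by apply: fr_prod.
Qed.

Lemma fr_adj m (A : I -> 'M[K]_m) :
  (forall i j, Q (fun c => A c i j)) -> forall i j, Q (fun c => (\adj (A c)) i j).
Proof.
move=> QA i j; apply: (fr_ext QR (h1 := fun c => cofactor (A c) j i)).
  by move=> c; rewrite mxE.
apply: (fr_mul QR); first exact: fr_cst.
apply: fr_det => a b; apply: (fr_ext QR (h1 := fun c => A c (lift j a) (lift i b))) => //.
by move=> c; rewrite !mxE.
Qed.

End FunctionRings.

Section Polynomial.
Variables (k : closedFieldType) (n : nat).
Local Notation kg := {mpoly k[n * n]}.
Implicit Types (f : kg) (g : 'M[k]_n) (lam : 'I_n -> int).

Lemma mpolyCX (c : k) m : (c ^+ m)%:MP = c%:MP ^+ m :> kg.
Proof. exact: rmorphXn. Qed.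

Lemma mpoly_poly_eq (P Q : {poly kg}) :
  (forall c : k, c != 0 -> P.[c%:MP] = Q.[c%:MP]) -> P = Q.
Proof.
exact: (poly_eq_nonzero_points (i := (@mpolyC (n * n) k : {rmorphism k -> kg}))).
Qed.

Lemma fr_pull (I : Type) (Q : (I -> kg) -> Prop) (QR : function_ring Q)
    (M : I -> 'M[kg]_n) f :
  (forall i j, Q (fun c => M c i j)) -> Q (fun c => pull (M c) f).
Proof.
move=> QM.
apply: (fr_ext QR (h1 := fun c => \sum_(m <- msupp f)
   (f@_m)%:MP * \prod_(l < n * n) mxvec (M c) 0 l ^+ m l)).
  move=> c; rewrite pull.unlock comp_mpolyEX; apply: eq_bigr => m _.
  rewrite comp_mpolyX -mul_mpolyC; congr (_ * _); apply: eq_bigr => l _.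
  by rewrite tnth_mktuple.
apply: fr_sum => // m; apply: (fr_mul QR); first exact: fr_cst.
apply: fr_prod => // l; apply: fr_exp => //.
by case/mxvec_indexP: l => i j; apply: (fr_ext QR _ (QM i j)) => c; rewrite mxvecE.
Qed.

Lemma fr_gact (I : Type) (Q : (I -> kg) -> Prop) (QR : function_ring Q)
    (g : I -> 'M[k]_n) f :
  (forall i j, Q (fun c => (g c i j)%:MP)) ->
  (forall i j, Q (fun c => (invmx (g c) i j)%:MP)) ->
  Q (fun c => gact (g c) f).
Proof.
move=> Qg Qi; apply: (fr_ext QR (h1 := fun c => pull (actmx (g c)) f)).
  by move=> c; rewrite gactE.
apply: fr_pull => //; apply: fr_mulmx => //.
  apply: fr_mulmx => // i j; last exact: fr_cst.
  by apply: (fr_ext QR _ (Qi i j)) => c; rewrite mxE.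
by move=> i j; apply: (fr_ext QR _ (Qg i j)) => c; rewrite mxE.
Qed.

Definition polyfun (h : k -> kg) := exists P : {poly kg}, forall c, h c = P.[c%:MP].

Lemma polyfun_ring : function_ring polyfun.
Proof.
split.
- by move=> h1 h2 e [P hP]; exists P => c; rewrite -e.
- by move=> a; exists a%:P => c; rewrite hornerC.
- by move=> h1 h2 [P hP] [R hR]; exists (P + R) => c; rewrite hornerD hP hR.
- by move=> h1 h2 [P hP] [R hR]; exists (P * R) => c; rewrite hornerM hP hR.
Qed.

Lemma polyfun_var : polyfun (fun c => c%:MP).
Proof. by exists 'X => c; rewrite hornerX. Qed.

(** Clearing the poles by c^N keeps the data in [{poly kg}]; the value of [h] at 0 is left
    unconstrained. *)
Definition laurent (h : k -> kg) :=
  exists N, exists P : {poly kg}, forall c, c != 0 -> c ^+ N *: h c = P.[c%:MP].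

Lemma laurent_ring : function_ring laurent.
Proof.
split.
- by move=> h1 h2 e [N [P hP]]; exists N, P => c c0; rewrite -e hP.
- by move=> a; exists 0%N, a%:P => c _; rewrite hornerC expr0 scale1r.
- move=> h1 h2 [N [P hP]] [L [R hR]].
  exists (N + L)%N, ('X^L * P + 'X^N * R) => c c0.
  rewrite hornerD !hornerM !hornerXn -hP // -hR // -!mpolyCX !mul_mpolyC !scalerA.
  by rewrite scalerDr -!exprD [(L + N)%N]addnC.
- move=> h1 h2 [N [P hP]] [L [R hR]]; exists (N + L)%N, (P * R) => c c0.
  by rewrite hornerM -hP // -hR // -scalerAl -scalerAr scalerA exprD.
Qed.

Lemma laurent_var : laurent (fun c => c%:MP).
Proof. by exists 0%N, 'X => c _; rewrite hornerX expr0 scale1r. Qed.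

Lemma laurent_inv : laurent (fun c => c^-1%:MP).
Proof.
exists 1%N, 1 => c c0; rewrite hornerC expr1.
by rewrite -mul_mpolyC -mpolyCM mulfV.
Qed.

Lemma polyfun_transv (i j a b : 'I_n) : polyfun (fun c => (transv i j c a b)%:MP).
Proof.
apply: (fr_ext polyfun_ring (h1 := fun c => (a == b)%:R%:MP + c%:MP * ((a == i) && (b == j))%:R%:MP)).
  by move=> c; rewrite transvE mpolyCD mpolyCM.
apply: (fr_add polyfun_ring); first exact: (fr_cst polyfun_ring).
by apply: (fr_mul polyfun_ring); [exact: polyfun_var | exact: (fr_cst polyfun_ring)].
Qed.

Lemma polyfun_transvN (i j a b : 'I_n) : polyfun (fun c => (transv i j (- c) a b)%:MP).
Proof.
have [P hP] := polyfun_transv i j a b; exists (P \Po - 'X) => c.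
by rewrite horner_comp hornerN hornerX -mpolyCN hP.
Qed.

Lemma polyfun_gact_transv (i j : 'I_n) f : i != j ->
  polyfun (fun c => gact (transv i j c) f).
Proof.
move=> ij; apply: (fr_gact polyfun_ring) => a b; first exact: polyfun_transv.
by apply: (fr_ext polyfun_ring _ (polyfun_transvN i j a b)) => c; rewrite inv_transv.
Qed.

(** Up to the factor [e], [R] and [S] are the two charts of a global section of the line bundle O(r)
    on the projective line. Only 0 exists for r < 0; for r = m the degree is at most m, and the
    coefficient of degree m in one chart is the value at the origin of the other. *)
Lemma poly_inversion (R S : {poly kg}) (e : k) (r : int) :
  (forall c, c != 0 -> R.[c%:MP] = (e * c ^ r) *: S.[c^-1%:MP]) ->
  (r < 0 -> R = 0) /\
  (forall m : nat, r = m -> (size R <= m.+1)%N /\ R`_m = e *: S`_0).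
Proof.
move=> hRS; pose D := size S.
(* [T] is [S] reversed: T(c) = c^D S(1/c) turns the gluing relation into an identity of
   polynomials. *)
pose T : {poly kg} := \sum_(i < D) S`_i *: 'X^(D - i).
have hT c : c != 0 -> T.[c%:MP] = c ^+ D *: S.[c^-1%:MP].
  move=> c0; rewrite horner_sum horner_coef scaler_sumr; apply: eq_bigr => i _.
  rewrite hornerZ hornerXn -!mpolyCX ![S`_i * _]mulrC !mul_mpolyC scalerA.
  by congr (_ *: _); rewrite exprVn expfB_cond // (negPf c0) add0n ltnW.
have Tgt l : (D < l)%N -> T`_l = 0.
  move=> Dl; rewrite coef_sum big1 // => i _; rewrite coefZ coefXn.
  by case: eqP => [e1|]; [lia | rewrite mulr0].
have TD : T`_D = S`_0.
  rewrite coef_sum; case D0: D => [|d].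
    by rewrite big_ord0 nth_default // -/D D0.
  rewrite big_ord_recl subn0 coefZ coefXn eqxx mulr1 big1 ?addr0 // => i _.
  by rewrite coefZ coefXn lift0; case: eqP => [e1|]; [lia | rewrite mulr0].
split=> [r0|m rm].
  have [m rm] : exists m, r = Negz m by case: r r0 {hRS} => // m; exists m.
  have E : 'X^(D + m.+1) * R = e%:MP *: T.
    apply: mpoly_poly_eq => c c0.
    rewrite hornerM hornerXn hornerZ hT // hRS // rm -mpolyCX !mul_mpolyC !scalerA.
    congr (_ *: _); rewrite NegzE -exprnN exprD [e * _]mulrC mulrA.
    by rewrite mulfK ?expf_neq0 // mulrC.
  apply/polyP => l; rewrite coef0.
  have := congr1 (fun P : {poly kg} => P`_(l + D + m.+1)) E.
  rewrite coefXnM coefZ Tgt ?mulr0; last by lia.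
  rewrite (_ : l + D + m.+1 - (D + m.+1) = l)%N; last by lia.
  by rewrite ifF => [->|] //; lia.
have E : 'X^D * R = e%:MP *: ('X^m * T).
  apply: mpoly_poly_eq => c c0.
  rewrite hornerM hornerXn hornerZ hornerM hornerXn hT // hRS // rm -!mpolyCX.
  rewrite !mul_mpolyC !scalerA; congr (_ *: _).
  by rewrite -exprnP; ring.
have RE l : R`_l = e%:MP * (if (l + D < m)%N then 0 else T`_(l + D - m)).
  have := congr1 (fun P : {poly kg} => P`_(l + D)) E.
  rewrite coefXnM coefZ coefXnM => <-.
  by rewrite addnK ifF //; lia.
split; last first.
  rewrite RE ifF; last by lia.
  by rewrite (_ : m + D - m = D)%N ?TD ?mul_mpolyC //; lia.
apply/leq_sizeP => l ml; rewrite RE ifF ?Tgt ?mulr0 //; lia.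
Qed.

End Polynomial.

(** * Highest weight vectors under the rank one subgroups *)

Section RankOne.
Variables (k : closedFieldType) (n : nat).
Local Notation kg := {mpoly k[n * n]}.
Implicit Types (f : kg) (g : 'M[k]_n) (lam : 'I_n -> int).

Lemma U_inv_wtU lam f g : U_inv_wt lam f -> in_U g -> gact g f = f.
Proof. by case=> fU _ /fU; rewrite act_gact. Qed.

Lemma U_inv_wtB lam f g : U_inv_wt lam f -> in_B g -> gact g f = chr lam g *: f.
Proof. by move=> /B_semi_invE fB /fB; rewrite act_gact. Qed.

Lemma tperm_mxK (a b : 'I_n) : tperm_mx a b *m tperm_mx a b = 1%:M :> 'M[k]_n.
Proof. by rewrite /tperm_mx -perm_mxM tperm2 perm_mx1. Qed.

Lemma tperm_mx_unit (a b : 'I_n) : (tperm_mx a b : 'M[k]_n) \in unitmx.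
Proof. by rewrite unitmx_perm. Qed.

(** For c nonzero and a < b, this is the upper triangular factor of [transv b a c] in the big cell:
    in rows and columns a, b it is the block with rows (c, 1) and (0, -1/c). The sign comes from
    using a transposition matrix, of determinant -1, as reflection. *)
Definition rank1_borel (a b : 'I_n) (c : k) : 'M[k]_n :=
  tperm_mx a b *m (transv a b (- c^-1) *m transv b a c).

Lemma rank1_factor (a b : 'I_n) c : a != b ->
  transv b a c = (transv a b c^-1 *m tperm_mx a b) *m rank1_borel a b c.
Proof.
move=> ab; rewrite /rank1_borel mulmxA -(mulmxA (transv a b c^-1)) tperm_mxK mulmx1.
by rewrite mulmxA transvN // mul1mx.
Qed.

Lemma rank1_borelE (a b : 'I_n) c i j : a != b -> c != 0 ->
  let i' := tperm a b i in
  rank1_borel a b c i j = (i' == j)%:R + c * ((i' == b) && (j == a))%:R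
    - c^-1 * ((i' == a) && (j == b))%:R - ((i' == a) && (j == a))%:R.
Proof.
move=> ab c0 i'; rewrite /rank1_borel /tperm_mx -row_permE mxE -/i'.
rewrite /transv mulmxDl mul1mx mulmxDr mulmx1 -scalemxAl -scalemxAr mul_delta_mx.
rewrite scalerA mulNr mulVf // !mxE.
by ring.
Qed.

Lemma rank1_borel_in_B (a b : 'I_n) c : (a < b)%N -> c != 0 ->
  in_B (rank1_borel a b c).
Proof.
move=> ab c0; have anb : a != b by rewrite neq_ltn ab.
split; first by rewrite !unitmx_mul tperm_mx_unit !transv_unit // eq_sym.
move=> i j ji; rewrite rank1_borelE //.
have neq (x y : 'I_n) : (x < y)%N -> (y == x = false) * (x == y = false).
  by move=> xy; split; apply/eqP => e; rewrite e ltnn in xy.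
case: tpermP => [ia|ib|/eqP ia /eqP ib].
- rewrite ia in ji; have jb := ltn_trans ji ab.
  by rewrite !(neq j a ji) !(neq j b jb) !andbF /= !mulr0 !subr0 addr0.
- rewrite ib in ji; rewrite !(neq a b ab) !(neq j b ji) eqxx andbF /=.
  by rewrite !mulr0 subr0 addr0 eq_sym subrr.
- by rewrite (negPf ia) (negPf ib) !(neq j i ji) /= !mulr0 !subr0 addr0.
Qed.

Lemma rank1_borel_chr lam (a b : 'I_n) c : (a < b)%N -> c != 0 ->
  chr lam (rank1_borel a b c) = c ^ lam a * (- c^-1) ^ lam b.
Proof.
move=> ab c0; have anb : a != b by rewrite neq_ltn ab.
have bna : b != a by rewrite eq_sym.
rewrite /chr (bigD1 a) //= (bigD1 b) //= big1 ?mulr1.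
  rewrite !rank1_borelE // tpermL tpermR !eqxx (negPf anb) (negPf bna) /=.
  by rewrite !mulr0 !mulr1 !subr0 !add0r.
move=> i /andP[ia ib]; rewrite rank1_borelE //.
have -> : tperm a b i = i by rewrite tpermD // eq_sym.
by rewrite (negPf ia) (negPf ib) eqxx /= !mulr0 !subr0 addr0 exp1rz.
Qed.

(* The two affine charts of the projective line of Borel subgroups of the
   rank one group attached to (a, b): the one-parameter orbits R and S of f
   in these charts are polynomial, and c <-> 1/c glues them. *)
Lemma rank1_charts lam f (a b : 'I_n) : U_inv_wt lam f -> (a < b)%N ->
  exists R S : {poly kg},
  [/\ forall c, gact (transv b a c) f = R.[c%:MP],
      forall d, gact (transv a b d) (gact (tperm_mx a b) f) = S.[d%:MP],
      lam a < lam b -> R = 0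
    & forall m : nat, lam a = lam b + m ->
        (size R <= m.+1)%N /\ R`_m = (-1) ^ lam b *: S`_0].
Proof.
move=> fU ab; have anb : a != b by rewrite neq_ltn ab.
have [R hR] : polyfun (fun c => gact (transv b a c) f).
  by apply: polyfun_gact_transv; rewrite eq_sym.
have [S hS] := polyfun_gact_transv (gact (tperm_mx a b) f) anb.
exists R, S.
have : forall c, c != 0 ->
    R.[c%:MP] = ((-1) ^ lam b * c ^ (lam a - lam b)) *: S.[c^-1%:MP].
  move=> c c0; have bB := rank1_borel_in_B ab c0.
  rewrite -hR -hS rank1_factor // actM; first last.
  - by case: bB.
  - by rewrite unitmx_mul tperm_mx_unit transv_unit.
  rewrite (U_inv_wtB fU bB) linearZ /= actM ?tperm_mx_unit ?transv_unit //.
  congr (_ *: _); rewrite rank1_borel_chr // -(mulN1r c^-1).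
  rewrite exprzMl ?unitrN1 ?unitfE ?invr_eq0 //.
  by rewrite expfzDr // mulrCA exprz_inv.
move=> /poly_inversion[h1 h2]; split=> // [lt|m e].
  by apply: h1; rewrite subr_lt0.
by apply: h2; rewrite e addrC addKr.
Qed.

(** Otherwise the chart [R] would be 0, while its value at 0 is [f]. *)
Lemma weight_dominant lam f (a b : 'I_n) :
  U_inv_wt lam f -> f != 0 -> (a < b)%N -> lam b <= lam a.
Proof.
move=> fU f0 ab; rewrite leNgt; apply: contra f0 => lt.
have [R [S [hR _ /(_ lt) R0 _]]] := rank1_charts fU ab.
by rewrite -[f]act1 -(transv0 k b a) hR R0 horner0.
Qed.

(** For equal weights the chart [R] is constant, hence equal to its value [f] at 0; its coefficient
    is also, up to sign, the value of [S] at 0, which is the reflected vector. *)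
Lemma lower_equal_weights lam f (a b : 'I_n) :
  U_inv_wt lam f -> (a < b)%N -> lam a = lam b ->
  (forall c, gact (transv b a c) f = f) /\
  f = (-1) ^ lam b *: gact (tperm_mx a b) f.
Proof.
move=> fU ab e; have [R [S [hR hS _ /(_ 0%N)]]] := rank1_charts fU ab.
case=> [|sR R0]; first by rewrite addr0.
have RC c : R.[c%:MP] = f.
  by rewrite (size1_polyC sR) hornerC -[f]act1 -(transv0 k b a) hR (size1_polyC sR) hornerC coefC.
split=> [c|]; first by rewrite hR.
have <- : S`_0 = gact (tperm_mx a b) f.
  by rewrite -horner_coef0 -[RHS]act1 -(transv0 k a b) hS mpolyC0.
by rewrite -R0 -horner_coef0 -mpolyC0 RC.
Qed.

(** Here [R] has degree at most 1: its constant term is [f], and its linear coefficient is up to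
    sign the reflected vector. *)
Lemma lower_adjacent_weights lam f (a b : 'I_n) :
  U_inv_wt lam f -> (a < b)%N -> lam a = lam b + 1 ->
  forall c, gact (transv b a c) f = f + (c * (-1) ^ lam b) *: gact (tperm_mx a b) f.
Proof.
move=> fU ab e c; have [R [S [hR hS _ /(_ 1%N e) [sR R1]]]] := rank1_charts fU ab.
have R0 : R`_0 = f.
  by rewrite -horner_coef0 -mpolyC0 -hR transv0 act1.
have <- : S`_0 = gact (tperm_mx a b) f.
  by rewrite -horner_coef0 -[RHS]act1 -(transv0 k a b) hS mpolyC0.
rewrite hR (horner_coef_wide _ sR) !big_ord_recl big_ord0 /= R0 expr0 mulr1.
by rewrite addr0 expr1 R1 mulrC mul_mpolyC scalerA.
Qed.

End RankOne.

(** * Coefficients of det(1 + zA) and of adj(1 + zA) *)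

Section PrincipalMinors.
Variable R : comNzRingType.

Lemma det_mxsub_bij (N n : nat) (A : 'M[R]_n) (h : 'I_N -> 'I_n) :
  bijective h -> \det (mxsub h h A) = \det A.
Proof.
move=> hb; have e : N = n by have := bij_eq_card hb; rewrite !card_ord.
subst N; pose s := perm (bij_inj hb).
have -> : mxsub h h A = row_perm s (col_perm s A).
  by apply/matrixP => i j; rewrite !mxE !permE.
rewrite row_permE col_permE !det_mulmx !det_perm mulrCA -signr_addb.
by rewrite odd_permV addbb mulr1.
Qed.

Local Notation pminor S A :=
  (\det (mxsub (@enum_val _ (mem S)) (@enum_val _ (mem S)) A)).

(** Listing the indices of [S] first makes the matrix block upper triangular, with an identity block
    in the lower right corner. *)
Lemma det_partial_identity (n : nat) (A : 'M[R]_n) (S : {set 'I_n}) :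
  \det (\matrix_(i, j) (if i \in S then A i j else (i == j)%:R)) = pminor S A.
Proof.
set M := \matrix_(i, j) _.
pose h (u : 'I_(#|S| + #|~: S|)) : 'I_n :=
  match split u with inl a => enum_val a | inr b => enum_val b end.
have hl a : h (lshift _ a) = enum_val a by rewrite /h (unsplitK (inl a)).
have hr b : h (rshift _ b) = enum_val b by rewrite /h (unsplitK (inr b)).
have hin (a : 'I_#|S|) : enum_val a \in S by exact: enum_valP.
have hout (b : 'I_#|~: S|) : (enum_val b \in S) = false.
  by apply/negbTE; have := enum_valP b; rewrite inE.
have hI : injective h.
  move=> u v; rewrite -[u]splitK -[v]splitK.
  case: (split u) => a; case: (split v) => b /=; rewrite ?hl ?hr.
  - by move=> /enum_val_inj ->.
  - by move=> e; have := hin a; rewrite e hout.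
  - by move=> e; have := hin b; rewrite -e hout.
  - by move=> /enum_val_inj ->.
rewrite -(det_mxsub_bij M (inj_card_bij hI _)); last by rewrite !card_ord cardsC card_ord.
rewrite -[mxsub h h M]submxK.
have -> : dlsubmx (mxsub h h M) = 0.
  apply/matrixP => i j; rewrite !mxE hl hr hout; case: eqP => // e.
  by have := hin j; rewrite -e hout.
have -> : drsubmx (mxsub h h M) = 1%:M.
  by apply/matrixP => i j; rewrite !mxE !hr hout (inj_eq enum_val_inj).
rewrite det_ublock det1 mulr1; congr (\det _).
by apply/matrixP => i j; rewrite !mxE !hl hin.
Qed.

End PrincipalMinors.

(** Reversing the characteristic polynomial makes s_i the coefficient of degree i, without a sign
    and with s_0 = 1. *)
Definition rev_char_mx (R : comNzRingType) n (A : 'M[R]_n) : 'M[{poly R}]_n :=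
  1%:M + 'X *: map_mx polyC A.

HB.lock Definition esymm (R : comNzRingType) n (A : 'M[R]_n) (i : nat) : R :=
  (\det (rev_char_mx A))`_i.

HB.lock Definition adjc (R : comNzRingType) n (A : 'M[R]_n) (j : nat) : 'M[R]_n :=
  \matrix_(a, b) (\adj (rev_char_mx A) a b)`_j.

Section ElementaryInvariants.

Variables (R : comNzRingType) (n : nat).
Implicit Types A B g : 'M[R]_n.

(** Multilinearity in the rows: each row of 1 + zA is the sum of a row of the identity and a row of
    zA, and S records the rows where the second summand is chosen. *)
Lemma det_rev_char_mx A :
  \det (rev_char_mx A) = \sum_(S : {set 'I_n}) 'X^#|S| *
    (\det (mxsub (@enum_val _ (mem S)) (@enum_val _ (mem S)) A))%:P.
Proof.
pose B := 'X *: map_mx polyC A.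
transitivity (\sum_(S : {set 'I_n}) \det (\matrix_(i, j)
    (if i \in S then B i j else (i == j)%:R))).
  rewrite exchange_big /=; apply: eq_bigr => s _; rewrite -big_distrr /=.
  congr (_ * _); under eq_bigr do rewrite mxE addrC.
  rewrite bigA_distr; apply: eq_bigr => S _; apply: eq_bigr => i _.
  by rewrite [in RHS]mxE; case: ifP; rewrite // mxE.
apply: eq_bigr => S _; rewrite det_partial_identity.
rewrite (_ : mxsub _ _ B = 'X *: map_mx polyC (mxsub (@enum_val _ (mem S)) (@enum_val _ (mem S)) A)).
  by rewrite detZ det_map_mx.
by apply/matrixP => i j; rewrite !mxE.
Qed.

Lemma esymmE A i : esymm A i = \sum_(S : {set 'I_n} | #|S| == i)
    \det (mxsub (@enum_val _ (mem S)) (@enum_val _ (mem S)) A).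
Proof.
rewrite esymm.unlock det_rev_char_mx coef_sum [RHS]big_mkcond; apply: eq_bigr => S _.
rewrite coefXnM coefC; case: ltngtP => //; last by move=> ->; rewrite subnn.
by move=> lt; rewrite subn_eq0 leqNgt lt.
Qed.

Lemma esymm0 A : esymm A 0 = 1.
Proof.
rewrite esymm.unlock -horner_coef0 -[LHS]/(horner_eval 0 _) -det_map_mx.
rewrite (_ : map_mx _ _ = 1%:M) ?det1 //; apply/matrixP => i j.
by rewrite !mxE rmorphD rmorphM /= /horner_eval hornerX mul0r addr0 hornerMn hornerC.
Qed.

Lemma esymm_gt A i : (n < i)%N -> esymm A i = 0.
Proof.
move=> ni; rewrite esymmE big_pred0 // => S; apply/negbTE.
by rewrite neq_ltn (leq_ltn_trans _ ni) // -[n in (_ <= n)%N]card_ord max_card.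
Qed.

Lemma esymm_tr A : esymm A^T =1 esymm A.
Proof.
move=> i; rewrite esymm.unlock -[in RHS]det_tr; congr (nth 0 (polyseq (\det _)) _).
by apply/matrixP => a b; rewrite !mxE eq_sym.
Qed.

Lemma adjcE A j a b : adjc A j a b = (\adj (rev_char_mx A) a b)`_j.
Proof. by rewrite adjc.unlock mxE. Qed.

(** Comparison of coefficients in (1 + zA) adj(1 + zA) = det(1 + zA), which is the Faddeev-LeVerrier
    recursion. *)
Lemma adjc_recl A j :
  adjc A 0 = 1%:M /\ adjc A j.+1 = (esymm A j.+1)%:M - A *m adjc A j.
Proof.
pose M := rev_char_mx A.
have E i a b : (adjc A i a b + if i == 0%N then 0 else (A *m adjc A i.-1) a b)
    = (a == b)%:R * esymm A i.
  have := congr1 (fun N : 'M[{poly R}]_n => (N a b)`_i) (mul_mx_adj M).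
  have XE (N : 'M[{poly R}]_n) : ('X *: N) a b = 'X * N a b by rewrite mxE.
  rewrite mulmxDl mul1mx -scalemxAl mxE XE coefD coefXM.
  rewrite [(_)%:M a b]mxE coefMn => e; rewrite mulr_natl esymm.unlock -e adjcE; congr (_ + _).
  case: eqP => // _; rewrite !mxE coef_sum; apply: eq_bigr => l _.
  by rewrite adjcE !mxE coefCM.
split; apply/matrixP => a b.
  by have := E 0%N a b; rewrite /= addr0 esymm0 mulr1 => ->; rewrite mxE.
have /= := E j.+1 a b; rewrite mulr_natl => e.
apply/eqP; rewrite [X in _ == X]mxE [(_)%:M a b]mxE -e.
have NE (N : 'M[R]_n) : (- N) a b = - N a b by rewrite mxE.
by rewrite NE addrK.
Qed.

Lemma adjc0 A : adjc A 0 = 1%:M.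
Proof. exact: (adjc_recl A 0).1. Qed.

Lemma adjcS A j : adjc A j.+1 = (esymm A j.+1)%:M - A *m adjc A j.
Proof. exact: (adjc_recl A j).2. Qed.

Lemma adjc_comm A j : A *m adjc A j = adjc A j *m A.
Proof.
elim: j => [|j IH]; first by rewrite adjc0 mulmx1 mul1mx.
rewrite adjcS mulmxBr mulmxBl -mulmxA -IH; congr (_ - _).
by rewrite mul_mx_scalar mul_scalar_mx.
Qed.

End ElementaryInvariants.

Section Intertwining.
Variables (K : fieldType) (n : nat) (x y g : 'M[K]_n).
Hypotheses (ug : g \in unitmx) (e : x *m g = g *m y).

Lemma esymm_intertwine : esymm x =1 esymm y.
Proof.
move=> i.
have E : rev_char_mx x *m map_mx polyC g = map_mx polyC g *m rev_char_mx y.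
  rewrite mulmxDl mulmxDr mul1mx mulmx1 -scalemxAl -scalemxAr -!map_mxM.
  by rewrite /= e.
have dg : \det (map_mx polyC g) != 0.
  by rewrite det_map_mx polyC_eq0 -unitfE -unitmxE.
have D : \det (rev_char_mx x) = \det (rev_char_mx y).
  by apply: (mulfI dg); rewrite [LHS]mulrC -!det_mulmx E.
by rewrite esymm.unlock D.
Qed.

Lemma adjc_intertwine(j : nat) : adjc x j *m g = g *m adjc y j.
Proof.
elim: j => [|j IH]; first by rewrite !adjc0 mulmx1 mul1mx.
rewrite !adjcS mulmxBl mulmxBr esymm_intertwine -mulmxA IH mulmxA e mulmxA.
by rewrite mul_scalar_mx mul_mx_scalar.
Qed.

End Intertwining.

(** * Differentials of the invariants s_j *)

Section Differentials.
Variables (k : closedFieldType) (n : nat).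
Local Notation kg := {mpoly k[n * n]}.
Local Notation X := (Defs.genmx k n).

Lemma s_esymm i : s k n i = esymm X i.
Proof. by rewrite esymmE. Qed.

Lemma ev_s x i : ev x (s k n i) = esymm x i.
Proof.
rewrite esymmE rmorph_sum; apply: eq_bigr => S _; rewrite -det_map_mx.
by rewrite map_mxsub map_ev_genmx.
Qed.

Lemma dxi_xi (a b i j : 'I_n) :
  dxi a b (xi k i j) = ((i == a) && (j == b))%:R.
Proof.
rewrite /dxi /xi mderivX mnmE.
have -> : (mxvec_index i j == mxvec_index a b) = (i == a) && (j == b).
  by rewrite /mxvec_index (inj_eq (@cast_ord_inj _ _ _)) (inj_eq enum_rank_inj).
case: andP => [[/eqP -> /eqP ->]|_]; last by rewrite scale0r.
rewrite scale1r (_ : (U_(_) - _)%MM = 0%MM) ?mpolyX0 //.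
by apply/mnmP => m; rewrite !mnmE subnn.
Qed.

(** The cofactor is computed without row [a], hence without the variable of position (a, b). [Z]
    collects the polynomials in z whose coefficients are all killed by the derivation; it is closed
    under sums and products. *)
Lemma dxi_cofactor (a b l : 'I_n) i :
  dxi a b (cofactor (rev_char_mx X) a l)`_i = 0.
Proof.
pose Z (p : {poly kg}) := forall i, dxi a b p`_i = 0.
have ZM p q : Z p -> Z q -> Z (p * q).
  move=> hp hq c; rewrite /dxi coefM raddf_sum big1 // => j _ /=.
  by rewrite mderivM -!/(dxi _ _ _) hp hq mul0r mulr0 addr0.
have Zc (c : k) : Z c%:MP%:P.
  by move=> j; rewrite coefC; case: ifP => _; rewrite /dxi ?mderivC ?raddf0.
have Zsign (m : nat) : Z ((-1) ^+ m).
  by have := Zc ((-1) ^+ m); rewrite mpolyCX mpolyCN mpolyC1 rmorphXn rmorphN1.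
have Zentry (u v : 'I_n) : u != a -> Z (rev_char_mx X u v).
  move=> ua j; rewrite /rev_char_mx mxE.
  have -> : ('X *: map_mx polyC X : 'M_n) u v = 'X * (xi k u v)%:P.
    by rewrite !mxE.
  have -> : (1%:M : 'M[{poly kg}]_n) u v = (u == v)%:R%:MP%:P.
    by rewrite mxE mpolyC_nat rmorph_nat.
  rewrite /dxi coefD coefXM mderivD -/(dxi a b _) Zc.
  rewrite add0r; case: ifP => _; first by rewrite mderiv0.
  rewrite coefC; case: ifP => _; last by rewrite mderiv0.
  by rewrite -/(dxi a b _) dxi_xi (negPf ua).
suff ZC : Z (cofactor (rev_char_mx X) a l) by exact: ZC.
apply: (ZM); first exact: Zsign.
have Zsum (I : Type) (r : seq I) (F : I -> {poly kg}) :
    (forall t, Z (F t)) -> Z (\sum_(t <- r) F t).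
  by move=> ZF j; rewrite /dxi coef_sum raddf_sum big1 // => t _; apply: ZF.
have Zprod (I : Type) (r : seq I) (F : I -> {poly kg}) :
    (forall t, Z (F t)) -> Z (\prod_(t <- r) F t).
  move=> ZF; elim: r => [|t r IH]; rewrite ?big_nil ?big_cons.
    by have := Zsign 0%N; rewrite expr0.
  exact: ZM.
apply: Zsum => t; apply: (ZM); first exact: Zsign.
apply: Zprod => u; rewrite 2!mxE; apply: Zentry.
by rewrite eq_sym neq_lift.
Qed.

(** In the expansion of det(1 + zX) along row [a], only the entry (a, b) depends on its variable,
    with derivative z. The derivative is z times a cofactor, so the index drops from j + 1 to j and
    the adjugate swaps a and b. *)
Lemma dxi_s (a b : 'I_n) j : dxi a b (s k n j.+1) = adjc X j b a.
Proof.
rewrite s_esymm esymm.unlock adjcE (expand_det_row _ a) coef_sum /dxi raddf_sum /=.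
rewrite (bigD1 b) //= big1 ?addr0 => [|l lb].
all: rewrite [rev_char_mx X _ _]mxE mulrDl coefD mderivD.
all: rewrite !mxE mulr_natl coefMn mderivMn -mulrA coefXM /= coefCM mderivM.
all: rewrite -!/(dxi _ _ _) !dxi_cofactor mulr0 addr0 mul0rn add0r dxi_xi eqxx.
  by rewrite eqxx mul1r.
by rewrite (negPf lb) mul0r.
Qed.

Lemma ev_adjc x j : map_mx (ev x) (adjc X j) = adjc x j.
Proof.
elim: j => [|j IH]; first by rewrite !adjc0 map_mx1.
by rewrite !adjcS map_mxB map_mxM map_ev_genmx IH map_scalar_mx -s_esymm /= ev_s.
Qed.

Lemma ev_dxi_s x (a b : 'I_n) j : ev x (dxi a b (s k n j.+1)) = adjc x j b a.
Proof. by rewrite dxi_s -ev_adjc [RHS]mxE. Qed.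

(** The entries are derivatives of s_(n+1), which is 0. This is the Cayley-Hamilton theorem. *)
Lemma adjc_n (x : 'M[k]_n) : adjc x n = 0.
Proof.
apply/matrixP => b a; rewrite -ev_dxi_s s_esymm esymm_gt //.
by rewrite /dxi raddf0 raddf0 mxE.
Qed.

End Differentials.

(** * The matrix H(x), its companion form and its minors *)

HB.lock Definition horner_mx_basis (k : fieldType) (m : nat) (x : 'M[k]_m.+1) :
  'M[k]_m.+1 := \matrix_(i, j) adjc x j i ord0.

Section HornerBasis.
Variables (k : closedFieldType) (m : nat).
Local Notation n := m.+1.
Implicit Types (x y g : 'M[k]_n).

Local Notation H := (@horner_mx_basis k m).

(** It sends e_j to c_(j+1) e_0 - e_(j+1), where e_n is read as 0: no row has index n, so the last
    column has no entry -1 from the second term. *)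
Definition companion (c : nat -> k) : 'M[k]_n :=
  \matrix_(i, j) ((if i == ord0 then c j.+1 else 0) - (i == j.+1 :> nat)%:R).

Lemma HE x i j : H x i j = adjc x j i ord0.
Proof. by rewrite horner_mx_basis.unlock mxE. Qed.

Lemma H_col0 x i : H x i ord0 = (i == ord0)%:R.
Proof. by rewrite HE adjc0 mxE. Qed.

(** Column j is the recursion [adjcS] applied to e_0; in the last column the remaining term vanishes
    by [adjc_n]. *)
Lemma H_companion x : x *m H x = H x *m companion (esymm x).
Proof.
apply/matrixP => i j.
have -> : (x *m H x) i j = (x *m adjc x j) i ord0.
  by rewrite !mxE; apply: eq_bigr => l _; rewrite HE.
have -> : x *m adjc x j = (esymm x j.+1)%:M - adjc x j.+1.
  by rewrite adjcS opprB addrC subrK.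
have -> : (H x *m companion (esymm x)) i j =
    \sum_l (H x i l * (if l == ord0 then esymm x j.+1 else 0)
            - H x i l * (l == j.+1 :> nat)%:R).
  by rewrite mxE; apply: eq_bigr => l _; rewrite [companion _ _ _]mxE mulrBr.
rewrite big_split /= (bigD1 ord0) //= big1 ?addr0; last first.
  by move=> l /negPf l0; rewrite l0 mulr0.
rewrite H_col0 mulr_natl sumrN mxE [(_)%:M _ _]mxE; congr (_ + _).
rewrite mxE; congr (- _).
have [jm|jm] := ltnP j.+1 n.
  rewrite (bigD1 (Ordinal jm)) //= eqxx mulr1 big1 ?addr0 => [|l ne]; first by rewrite HE.
  by rewrite -(inj_eq val_inj) /= in ne; rewrite (negPf ne) mulr0.
rewrite big1 => [|l _]; last by rewrite ltn_eqF ?mulr0 // (leq_trans (ltn_ord l)).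
have -> : j.+1 = n by apply/eqP; rewrite eqn_leq jm ltn_ord.
by rewrite adjc_n mxE.
Qed.

(** Since g scales e_0 by its corner entry, this is [adjc_intertwine] read on the first column. *)
Lemma H_intertwine x y g : g \in unitmx -> x *m g = g *m y ->
  (forall i, i != ord0 -> g i ord0 = 0) -> g ord0 ord0 *: H x = g *m H y.
Proof.
move=> ug e g0; apply/matrixP => i j.
have -> : (g *m H y) i j = (g *m adjc y j) i ord0.
  by rewrite !mxE; apply: eq_bigr => l _; rewrite HE.
rewrite -(adjc_intertwine ug e) [LHS]mxE HE [RHS]mxE (bigD1 ord0) //= big1 ?addr0 1?mulrC //.
by move=> l l0; rewrite g0 // mulr0.
Qed.

Definition lrow (t : nat) (a : 'I_t) : 'I_n := inord (n - t + a).

Lemma lrow_lt t (a : 'I_t) : (t <= n)%N -> (n - t + a < n)%N.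
Proof. by move=> tn; have := ltn_ord a; lia. Qed.

Lemma val_lrow t (a : 'I_t) : (t <= n)%N -> lrow a = (n - t + a)%N :> nat.
Proof. by move=> tn; rewrite inordK // lrow_lt. Qed.

Lemma big_lrow (T : Type) (idx : T) (op : Monoid.com_law idx) t (F : 'I_n -> T) :
  (0 < t <= n)%N ->
  \big[op/idx]_(i < n | (n - t <= i)%N) F i = \big[op/idx]_(a < t) F (lrow a).
Proof.
case/andP=> t0 tn.
rewrite (reindex_onto (@lrow t) (fun i : 'I_n => insubd (Ordinal t0) (i - (n - t))%N)).
  apply: eq_bigl => a; rewrite val_lrow // leq_addr addKn; apply/eqP.
  by rewrite valKd.
move=> i hi; apply: val_inj; rewrite /= val_lrow // val_insubd.
have li := ltn_ord i; rewrite ifT; lia.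
Qed.

Lemma nat_ordE (d : 'I_n) i : (i < n)%N -> nat_ord d i = inord i.
Proof. by move=> h; apply: val_inj; rewrite /= val_insubd h inordK. Qed.

Lemma ev_u x (I : {set 'I_n}) :
  ev x (u_ k I) = \det (mxsub (@lrow #|I|) (@enum_val _ (mem I)) (H x)).
Proof.
rewrite -det_map_mx; congr (\det _); apply/matrixP => a b.
rewrite [LHS]mxE [in LHS]mxE [RHS]mxE HE /=.
have In : (#|I| <= n)%N by rewrite -[n in (_ <= n)%N]card_ord max_card.
rewrite !nat_ordE //; last exact: lrow_lt.
by rewrite ev_dxi_s -/(lrow a) (_ : inord 0 = ord0 :> 'I_n) //; apply: ord_inj; rewrite /= inordK.
Qed.

(** At x = 0 every [adjc] of positive index vanishes, so the minor has a zero column. Combinations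
    of the u are therefore not units. *)
Lemma ev_u0 (I : {set 'I_n}) t : (0 < t)%N -> @Iadm n t I -> ev 0 (u_ k I) = 0.
Proof.
move=> t0 /andP[/'forall_implyP I0 /eqP It]; rewrite ev_u -det_tr.
have h0 : (0 < #|I|)%N by rewrite It.
rewrite (expand_det_row _ (Ordinal h0)) big1 // => a _.
rewrite 2!mxE HE; have := I0 _ (enum_valP (Ordinal h0)).
case: (enum_val _) => [[|j] hj] // _ /=.
suff -> : adjc (0 : 'M[k]_n) j.+1 = 0 by rewrite mxE mul0r.
rewrite adjcS mul0mx subr0 esymm.unlock.
suff -> : rev_char_mx (0 : 'M[k]_n) = 1%:M by rewrite det1 coef1 raddf0.
by rewrite /rev_char_mx map_mx0 scaler0 addr0.
Qed.

Lemma chr_lam t g : (0 < t < n)%N ->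
  chr (@lam_ n t) g = g ord0 ord0 ^+ t * \prod_(a < t) (g (lrow a) (lrow a))^-1.
Proof.
case/andP=> t0 tn; rewrite /chr (bigD1 ord0) //=; congr (_ * _).
rewrite -(big_lrow _ (fun i => (g i i)^-1)) ?t0 1?ltnW // big_mkcond [RHS]big_mkcond /=.
apply: eq_bigr => i _; rewrite /lam_ -(inj_eq val_inj) /=.
case: eqP => [->|_] /=; first by rewrite leqn0 subn_eq0 leqNgt tn.
by case: ifP.
Qed.

(** The last rows of g H(y) involve only the last rows of H(y), because g is upper triangular. Hence
    the minor of g H(y) is the minor of H(y) times t diagonal entries of g, while the corner entry
    contributes its t-th power by [H_intertwine]. *)
Lemma u_B_semi_inv t (I : {set 'I_n}) : (0 < t < n)%N -> @Iadm n t I ->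
  B_semi_inv (@lam_ n t) (u_ k I).
Proof.
move=> /[dup] tn /andP[t0 tn'] /andP[_ /eqP It] g gB.
rewrite act_gact; apply: ev_inj => x; rewrite ev_act linearZ /=.
case: (gB) => ug gup; set y := invmx g *m x *m g.
have e : x *m g = g *m y by rewrite /y !mulmxA mulmxV // mul1mx.
have gc i : i != ord0 -> g i ord0 = 0.
  by move=> i0; apply: gup; rewrite lt0n.
have E := H_intertwine ug e gc.
have := congr1 (fun M => \det (mxsub (@lrow #|I|) (@enum_val _ (mem I)) M)) E.
have -> : mxsub (@lrow #|I|) (@enum_val _ (mem I)) (g ord0 ord0 *: H x) =
    g ord0 ord0 *: mxsub (@lrow #|I|) (@enum_val _ (mem I)) (H x).
  by apply/matrixP => a b; rewrite !mxE.
have -> : mxsub (@lrow #|I|) (@enum_val _ (mem I)) (g *m H y) =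
    mxsub (@lrow #|I|) (@lrow #|I|) g *m mxsub (@lrow #|I|) (@enum_val _ (mem I)) (H y).
  apply/matrixP => a b; rewrite !mxE.
  rewrite (bigID (fun l : 'I_n => (n - #|I| <= l)%N)) /= addrC big1 ?add0r => [|l hl].
    rewrite big_lrow; last by rewrite It t0 ltnW.
    by apply: eq_bigr => c _; rewrite !mxE.
  rewrite gup ?mul0r // val_lrow; last by rewrite It ltnW.
  by move: hl; rewrite -ltnNge => hl; apply: leq_trans hl (leq_addr _ _).
rewrite detZ det_mulmx -(ev_u x I) -(ev_u y I) upper_det; last first.
  move=> a b ba; rewrite mxE gup // !val_lrow ?It ?(ltnW tn') //.
  by rewrite ltn_add2l.
rewrite chr_lam // -It => h; rewrite mulrAC h mulrAC -big_split /= big1 ?mul1r //.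
by move=> a _; rewrite mxE mulfV // in_B_diag.
Qed.

End HornerBasis.

(** * Generation by transvections and diagonal matrices *)

Section Generation.
Variable k : closedFieldType.

(** The predicate [P] selects the transvections, so that one notion serves both the full linear
    group and the group of matrices with first column e_0. *)
Definition row_closed n (P : pred ('I_n * 'I_n)) (K : 'M[k]_n -> Prop) : Prop :=
  (forall i j c g, i != j -> P (i, j) -> K g -> K (transv i j c *m g)) /\
  (forall (d : 'rV[k]_n) g, (forall i, d 0 i != 0) -> K g -> K (diag_mx d *m g)).

Section Block.
Variable n : nat.
Implicit Types (r : 'rV[k]_n) (K : 'M[k]_(1 + n) -> Prop).

Let upper r : 'M[k]_(1 + n) := block_mx 1%:M r 0 1%:M.
Let lower c : 'M[k]_(1 + n) := block_mx 1%:M 0 c 1%:M.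
Let corner (g : 'M[k]_n) : 'M[k]_(1 + n) := block_mx 1%:M 0 0 g.

Lemma transv_upper j c : transv (lshift n 0) (rshift 1 j) c = upper (c *: delta_mx 0 j).
Proof.
apply/matrixP => a b; rewrite transvE /upper.
case: (split_ordP a) => a' ->; case: (split_ordP b) => b' ->.
- by rewrite block_mxEul !mxE !ord1 eqxx !(eq_lrshift, eq_rlshift) andbF mulr0 addr0.
- by rewrite block_mxEur !mxE !ord1 eq_lrshift eqxx add0r eq_rshift.
- by rewrite block_mxEdl !mxE !eq_rlshift mulr0 addr0.
- by rewrite block_mxEdr !mxE !eq_rshift eq_rlshift mulr0 addr0.
Qed.

Lemma transv_lower j c : transv (rshift 1 j) (lshift n 0) c = lower (c *: delta_mx j 0).
Proof.
apply/matrixP => a b; rewrite transvE /lower.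
case: (split_ordP a) => a' ->; case: (split_ordP b) => b' ->.
- by rewrite block_mxEul !mxE !ord1 eqxx !(eq_lrshift, eq_rlshift) mulr0 addr0.
- by rewrite block_mxEur !mxE !ord1 !eq_lrshift mulr0 addr0.
- by rewrite block_mxEdl !mxE !ord1 eq_rlshift eqxx add0r eq_rshift.
- by rewrite block_mxEdr !mxE !eq_rshift eq_rlshift andbF mulr0 addr0.
Qed.

Lemma transv_corner i j c : transv (rshift 1 i) (rshift 1 j) c = corner (transv i j c).
Proof.
apply/matrixP => a b; rewrite transvE /corner.
case: (split_ordP a) => a' ->; case: (split_ordP b) => b' ->.
- by rewrite block_mxEul !mxE !ord1 eqxx !(eq_lrshift, eq_rlshift) mulr0 addr0.
- by rewrite block_mxEur !mxE !ord1 !eq_lrshift mulr0 addr0.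
- by rewrite block_mxEdl !mxE !eq_lrshift eq_rlshift andbF mulr0 addr0.
- by rewrite block_mxEdr transvE !eq_rshift.
Qed.

Lemma upper_closed P K r g : row_closed P K -> (forall j, P (lshift n 0, rshift 1 j)) ->
  K g -> K (upper r *m g).
Proof.
move=> [Kt _] Pj; rewrite [r]row_sum_delta; move: g; elim/big_ind: _ => [|u v IHu IHv|j _] g Kg.
- by rewrite /upper -scalar_mx_block mul1mx.
- have -> : upper (u + v) = upper u *m upper v.
    by rewrite /upper mulmx_block !mul1mx !mul0mx !mulmx1 !mulmx0 !addr0 add0r addrC.
  by rewrite -mulmxA; apply/IHu/IHv.
- by rewrite -transv_upper; apply: Kt => //; rewrite eq_lrshift.
Qed.

Lemma lower_closed P K (c : 'cV[k]_n) g : row_closed P K -> (forall j, P (rshift 1 j, lshift n 0)) ->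
  K g -> K (lower c *m g).
Proof.
move=> [Kt _] Pj.
have -> : c = \sum_j c j 0 *: delta_mx j 0.
  by rewrite [LHS]matrix_sum_delta; apply: eq_bigr => j _; rewrite big_ord1.
move: g; elim/big_ind: _ => [|u v IHu IHv|j _] g Kg.
- by rewrite /lower -scalar_mx_block mul1mx.
- have -> : lower (u + v) = lower u *m lower v.
    by rewrite /lower mulmx_block !mul1mx !mul0mx !mulmx1 !mulmx0 !addr0 add0r.
  by rewrite -mulmxA; apply/IHu/IHv.
- by rewrite -transv_lower; apply: Kt => //; rewrite eq_rlshift.
Qed.

(** The matrix is a unipotent row block times the block diagonal matrix of 1 and g. The first
    premise on [K'] is the induction hypothesis of [elementary_generation], which calls this lemma
    in smaller size. *)
Lemma first_column_generation K :
  (forall K' : 'M[k]_n -> Prop, row_closed predT K' -> K' 1%:M ->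
     forall g, g \in unitmx -> K' g) ->
  row_closed (fun ij => ij.2 != lshift n 0) K -> K 1%:M ->
  forall r (g : 'M_n), g \in unitmx -> K (block_mx 1%:M r 0 g).
Proof.
move=> IH KC K1 r g ug.
have -> : block_mx 1%:M r 0 g = upper (r *m invmx g) *m corner g :> 'M[k]_(1 + n).
  rewrite /upper /corner mulmx_block !mul1mx !mul0mx !mulmx0 !addr0 !add0r.
  by rewrite mulmxKV.
apply: (upper_closed _ KC) => [j|]; first by [].
apply: (IH (fun g => K (corner g))) => //; last by rewrite /corner -scalar_mx_block.
have cornerM a b : corner (a *m b) = corner a *m corner b.
  by rewrite /corner mulmx_block !mul1mx !mul0mx !mulmx0 !addr0 !add0r.
case: KC => Kt Kd; split=> [i j c h ij _ Kh|d h d0 Kh].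
  by rewrite cornerM -transv_corner; apply: Kt.
have -> : corner (diag_mx d *m h) = diag_mx (row_mx (1 : 'rV_1) d) *m corner h.
  rewrite cornerM diag_mx_row; congr (block_mx _ _ _ _ *m _).
  by apply/matrixP => a b; rewrite !mxE !ord1 eqxx.
apply: Kd => // i; case: (split_ordP i) => i' ->; last by rewrite row_mxEr.
by rewrite row_mxEl ord1 mxE eqxx oner_neq0.
Qed.

End Block.

(** Gaussian elimination by induction on the size. If the corner entry is 0, a transvection first
    adds to row 0 a row with a nonzero entry in column 0. *)
Lemma elementary_generation n (K : 'M[k]_n -> Prop) :
  row_closed predT K -> K 1%:M -> forall g, g \in unitmx -> K g.
Proof.
elim: n K => [|n IH] K KC K1 g ug; first by rewrite (_ : g = 1%:M) //; apply/matrixP => -[].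
have KQ : row_closed (fun ij => ij.2 != @lshift 1 n 0) K.
  by case: KC => Kt Kd; split=> // i j c h ij _; apply: Kt.
have main (h : 'M[k]_(1 + n)) : h \in unitmx -> h (@lshift 1 n 0) (@lshift 1 n 0) != 0 -> K h.
  rewrite -[h]submxK; set a := ulsubmx h; set r := ursubmx h.
  set c := dlsubmx h; set h' := drsubmx h; rewrite block_mxEul => uh a0.
  have ea : a = (a 0 0)%:M by apply: mx11_scalar.
  pose s := (a 0 0)^-1.
  (* Block elimination with pivot a; the lower right block left over is the Schur complement. *)
  have E : block_mx a r c h' = block_mx 1%:M 0 (s *: c) 1%:M *m
      (diag_mx (row_mx (a 0 0)%:M (const_mx 1)) *m
       block_mx 1%:M (s *: r) 0 (h' - s *: (c *m r))).
    rewrite diag_mx_row !mulmx_block !mul1mx !mul0mx !mulmx0 !mulmx1 !addr0 !add0r.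
    rewrite diag_const_mx mul1mx.
    have -> : diag_mx ((a 0 0)%:M : 'rV_1) = (a 0 0)%:M.
      by apply/matrixP => u v; rewrite !mxE !ord1 eqxx.
    rewrite !(mul_mx_scalar, mul_scalar_mx) -ea; congr (block_mx a _ _ _).
    - by rewrite scalerA mulfV // scale1r.
    - by rewrite scalerA mulfV // scale1r.
    - rewrite -scalemxAl -!scalemxAr !scalerA mulfV // mulr1.
      by rewrite addrC subrK.
  rewrite E; apply: (lower_closed _ KC) => //.
  have d0 (i : 'I_(1 + n)) : (row_mx (a 0 0)%:M (const_mx 1) : 'rV[k]_(1 + n)) 0 i != 0.
    case: (split_ordP i) => i' ->; first by rewrite row_mxEl !ord1 mxE eqxx.
    by rewrite row_mxEr mxE oner_neq0.
  case: (KC) => _ Kd; apply: (Kd _ _ d0).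
  apply: (first_column_generation (@IH)) => //.
  move: uh; rewrite E !unitmx_mul => /and3P[_ _].
  by rewrite !unitmxE det_ublock det1 mul1r.
have [g0|] := eqVneq (g (@lshift 1 n 0) (@lshift 1 n 0)) 0; last exact: main.
have [i gi] : exists i, g i (@lshift 1 n 0) != 0.
  case: (boolP [exists i, g i (@lshift 1 n 0) != 0]) => [/existsP //|/existsPn h].
  move: ug; rewrite unitmxE -det_tr (expand_det_row _ (@lshift 1 n 0)) big1 ?unitr0 // => j _.
  by rewrite mxE (eqP (negbNE (h j))) mul0r.
have i0 : @lshift 1 n 0 != i by apply: contraNneq gi => <-; rewrite g0.
have -> : g = transv (@lshift 1 n 0) i (-1) *m (transv (@lshift 1 n 0) i 1 *m g).
  by rewrite mulmxA transvD // addNr transv0 mul1mx.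
case: (KC) => Kt _; apply: Kt => //; apply: main.
  by rewrite unitmx_mul transv_unit.
rewrite mulmxDl mul1mx -scalemxAl mxE g0 add0r scale1r mxE (bigD1 i) //= big1 ?addr0.
  by rewrite mxE !eqxx mul1r.
by move=> j ji; rewrite mxE (negPf ji) andbF mul0r.
Qed.

Lemma first_column_group_generation m (K : 'M[k]_m.+1 -> Prop) :
  row_closed (fun ij => ij.2 != ord0) K -> K 1%:M ->
  forall g, g \in unitmx -> (forall i, g i ord0 = (i == ord0)%:R) -> K g.
Proof.
have o : ord0 = @lshift 1 m 0 by apply: ord_inj.
rewrite o => KC K1; change (forall g : 'M[k]_(1 + m), g \in unitmx ->
  (forall i, g i (@lshift 1 m 0) = (i == @lshift 1 m 0)%:R) -> K g).
move=> g; rewrite -[g]submxK => ug g0.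
have eul : ulsubmx g = 1%:M.
  by apply/matrixP => i j; rewrite !ord1 [RHS]mxE -(block_mxEul (ulsubmx g) (ursubmx g) (dlsubmx g) (drsubmx g)) g0.
have edl : dlsubmx g = 0.
  apply/matrixP => i j; rewrite !ord1 [RHS]mxE -(block_mxEdl (ulsubmx g) (ursubmx g) (dlsubmx g) (drsubmx g)) g0.
  by rewrite eq_rlshift.
move: ug; rewrite eul edl unitmxE det_ublock det1 mul1r -unitmxE => ug.
apply: first_column_generation => // K'; exact: elementary_generation.
Qed.

End Generation.

(** * Conjugates of a matrix and permutation matrices *)

Section Conjugation.
Variables (k : closedFieldType) (n : nat).
Local Notation kg := {mpoly k[n * n]}.
Implicit Types (f : kg) (g h x y : 'M[k]_n) (lam : 'I_n -> int).

Definition cj g x : 'M[k]_n := g *m x *m invmx g.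

Lemma cjM g h x : g \in unitmx -> h \in unitmx -> cj (g *m h) x = cj g (cj h x).
Proof. by move=> ug uh; rewrite /cj invmxM // !mulmxA. Qed.

Lemma cj_mul g x : g \in unitmx -> cj g x *m g = g *m x.
Proof. by move=> ug; rewrite /cj mulmxKV. Qed.

Lemma ev_cj g x f : ev (cj g x) f = ev x (gact (invmx g) f).
Proof. by rewrite ev_act invmxK. Qed.

Lemma gact_invB lam g f : U_inv_wt lam f -> in_B g ->
  gact (invmx g) f = (chr lam g)^-1 *: f.
Proof.
move=> fU gB; have [ug _] := gB; have c0 := chr_neq0 lam gB.
have := congr1 (gact (invmx g)) (U_inv_wtB fU gB).
rewrite -actM ?unitmx_inv // mulVmx // act1 linearZ /= => e.
by rewrite {2}e scalerA mulVf // scale1r.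
Qed.

Lemma perm_transv (s : 'S_n) i j (c : k) :
  perm_mx s *m transv i j c = transv ((s^-1)%g i) ((s^-1)%g j) c *m perm_mx s.
Proof.
rewrite /transv mulmxDl mulmxDr mulmx1 mul1mx -scalemxAl -scalemxAr.
congr (_ + _ *: _); apply/matrixP => a b.
rewrite -row_permE mxE mxE [RHS]mxE (bigD1 ((s^-1)%g j)) //= big1 ?addr0.
  rewrite !mxE permKV eqxx andbT -natrM mulnb; congr (_ && _)%:R.
    by apply/eqP/eqP => [<-|->]; rewrite ?permK ?permKV.
  by rewrite eq_sym.
by move=> l lj; rewrite mxE (negPf lj) andbF mul0r.
Qed.

Lemma perm_mxE (s : 'S_n) i j : (perm_mx s : 'M[k]_n) i j = (s i == j)%:R.
Proof. by rewrite !mxE. Qed.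

Lemma perm_diag (s : 'S_n) (d : 'rV[k]_n) :
  perm_mx s *m diag_mx d = diag_mx (\row_i d 0 (s i)) *m perm_mx s.
Proof.
apply/matrixP => a b; rewrite -row_permE mxE mul_diag_mx !mxE.
by case: eqP; rewrite ?mulr1n ?mulr1 ?mulr0n ?mulr0.
Qed.

Lemma inv_tperm_mx (a b : 'I_n) : invmx (tperm_mx a b) = tperm_mx a b :> 'M[k]_n.
Proof. by apply: invmx_eq; rewrite tperm_mxK. Qed.

Lemma cj_tperm (a b : 'I_n) (s : 'S_n) x :
  cj (tperm_mx a b) (cj (perm_mx s) x) = cj (perm_mx (tperm a b * s)%g) x.
Proof. by rewrite perm_mxM cjM ?unitmx_perm. Qed.

End Conjugation.

(** * The module basis in weight lambda^t *)

Section Weight.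
Variables (k : closedFieldType) (m t : nat).
Local Notation n := m.+1.
Hypothesis (ht : (0 < t < n)%N).
Local Notation kg := {mpoly k[n * n]}.
Local Notation lam := (@lam_ n t).
Implicit Types (f : kg) (x y : 'M[k]_n) (s : 'S_n).

Lemma lam_nz (a : 'I_n) : a != ord0 -> lam a = if (n - t <= a)%N then -1 else 0.
Proof. by rewrite /lam_ -(inj_eq val_inj) /= => /negPf ->. Qed.

(** Away from index 0 the weight falls once, from 0 to -1; the two rank one lemmas then cover every
    lower root subgroup that avoids index 0. *)
Lemma lam_step (a b : 'I_n) : a != ord0 -> (a < b)%N ->
  lam a = lam b \/ lam a = lam b + 1.
Proof.
move=> a0 ab; have b0 : b != ord0 by rewrite -lt0n (leq_ltn_trans _ ab).
rewrite !lam_nz //; case: ifP => ha; case: ifP => hb; rewrite ?addNr; auto.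
by move: hb; rewrite (leq_trans ha (ltnW ab)).
Qed.

Lemma vanishing_spreads f y (h : 'M[k]_n) : U_inv_wt lam f ->
  (forall s, s ord0 = ord0 -> ev (cj (perm_mx s) y) f = 0) ->
  h \in unitmx -> (forall i, h i ord0 = (i == ord0)%:R) ->
  ev (cj h y) f = 0.
Proof.
move=> fU f0 uh h0.
(* Asking for vanishing at all permutations fixing 0 at once makes [K] stable: moving a transvection
   across a permutation matrix renames its indices, and the reflected vector only changes the
   permutation. *)
pose K (g : 'M[k]_n) := g \in unitmx /\
  forall s, s ord0 = ord0 -> ev (cj (perm_mx s *m g) y) f = 0.
suff [_ /(_ 1%g)] : K h by rewrite perm1 perm_mx1 mul1mx; apply.
apply: first_column_group_generation uh h0; last first.
  by split=> [|s s0]; rewrite ?unitmx1 // mulmx1 f0.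
have up s : perm_mx s \in @unitmx k n by rewrite unitmx_perm.
split=> [i j c g ij /= j0 [ug Kg]|d g d0 [ug Kg]]; split=> [|s s0].
- by rewrite unitmx_mul transv_unit.
- set i' := (s^-1)%g i; set j' := (s^-1)%g j.
  have ij' : i' != j' by rewrite (inj_eq perm_inj).
  have j0' : j' != ord0.
    by apply: contraNneq j0 => e; rewrite -[j](permKV s) -/j' e s0.
  rewrite mulmxA perm_transv -mulmxA cjM ?transv_unit ?unitmx_mul ?up //.
  rewrite ev_cj inv_transv //; case: (ltngtP i' j') => [lt|lt|/ord_inj e].
  + by rewrite (U_inv_wtU fU (transv_in_U _ lt)) Kg.
  + case: (lam_step j0' lt) => e.
      by rewrite (lower_equal_weights fU lt e).1 Kg.
    (* The extra term is the value of f at the permutation composed with the transposition of i' and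
       j'; both indices are nonzero, so 0 stays fixed. *)
    rewrite (lower_adjacent_weights fU lt e) linearD linearZ /= Kg // add0r.
    rewrite -(inv_tperm_mx k j' i') -ev_cj.
    rewrite -cjM ?unitmx_mul ?up ?tperm_mx_unit // mulmxA -perm_mxM Kg ?mulr0 //.
    have i0' : ord0 != i' by rewrite eq_sym -lt0n (leq_ltn_trans _ lt).
    by rewrite permM tpermD // eq_sym.
  + by rewrite e eqxx in ij'.
- by rewrite unitmx_mul ug andbT; case: (diag_in_T d0).
- have dB : in_B (diag_mx (\row_i d 0 (s i))).
    by apply/in_T_in_B/diag_in_T => i; rewrite mxE.
  rewrite mulmxA perm_diag -mulmxA cjM ?unitmx_mul ?up ?(proj1 dB) //.
  by rewrite ev_cj (gact_invB fU dB) linearZ /= Kg // mulr0.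
Qed.

(* Permutations sending {n-t, ..., n-1} to the same set differ by transpositions
   inside blocks of equal weight, which multiply f by a sign. *)
Lemma vanishing_block_perm f y (s r : 'S_n) : U_inv_wt lam f ->
  s ord0 = ord0 -> r ord0 = ord0 ->
  (forall v, (n - t <= (s^-1)%g v)%N = (n - t <= (r^-1)%g v)%N) ->
  ev (cj (perm_mx r) y) f = 0 -> ev (cj (perm_mx s) y) f = 0.
Proof.
move=> fU s0 r0 sr fr; have [N] := ubnP #|[set i | s i != r i]|.
elim: N s s0 sr => // N IH s s0 sr lN.
have [/eqP e|] := eqVneq #|[set i | s i != r i]| 0%N.
  suff -> : s = r by [].
  apply/permP => i; move: e; rewrite cards_eq0 => /eqP/setP/(_ i).
  by rewrite !inE => /negbT; rewrite negbK => /eqP.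
rewrite cards_eq0 => /set0Pn[i]; rewrite inE => sri.
(* Swapping i and j makes s agree with r at i. It loses no agreement, since s and r already differ
   at j. *)
pose j := (s^-1)%g (r i).
have sj : s j = r i by rewrite permKV.
have ji : j != i by apply: contraNneq sri => e; rewrite -sj e.
have blk : (n - t <= j)%N = (n - t <= i)%N by rewrite sr permK.
have i0 : i != ord0 by apply: contraNneq sri => ->; rewrite s0 r0.
have j0 : j != ord0.
  by apply: contraNneq i0 => e; apply/eqP/(@perm_inj _ r); rewrite -sj e s0 r0.
pose s' := (tperm i j * s)%g.
have s'E l : s' l = s (tperm i j l) by rewrite permM.
suff fs' : ev (cj (perm_mx s') y) f = 0.
  have sgn (a b : 'I_n) : (a < b)%N -> lam a = lam b ->
      tperm a b = tperm i j -> ev (cj (perm_mx s) y) f = 0.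
    move=> ab e et; rewrite (lower_equal_weights fU ab e).2 linearZ /=.
    by rewrite -(inv_tperm_mx k a b) -ev_cj cj_tperm et fs' mulr0.
  case: (ltngtP i j) => [lt|lt|/ord_inj e]; last by rewrite e eqxx in ji.
    by apply: (sgn i j) => //; rewrite !lam_nz // blk.
  by apply: (sgn j i) => //; [rewrite !lam_nz // blk | exact: tpermC].
apply: IH; first by rewrite s'E tpermD.
  move=> v; rewrite -sr.
  have -> : (s'^-1)%g v = tperm i j ((s^-1)%g v).
    by apply: (@perm_inj _ s'); rewrite permKV s'E tpermK permKV.
  by case: tpermP => // ->; rewrite blk.
rewrite -ltnS; apply: leq_trans lN; rewrite ltnS; apply: proper_card.
apply/properP; split; last by exists i; rewrite inE // s'E tpermL sj eqxx.
apply/subsetP => l; rewrite !inE s'E; case: tpermP => [->|->|//].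
  by rewrite sj eqxx.
by move=> _; rewrite sj; apply: contraNneq ji => /perm_inj ->.
Qed.

Lemma Iadm_card I : @Iadm n t I -> #|I| = t.
Proof. by case/andP => _ /eqP. Qed.

Lemma Iadm_0 I : @Iadm n t I -> ord0 \notin I.
Proof. by case/andP => /'forall_implyP h _; apply/negP => /h. Qed.

Definition sec_pred (J : {set 'I_n}) s : bool :=
  (s ord0 == ord0) && [forall a : 'I_#|J|, s (lrow m a) == enum_val a].

(** A representative of the permutations fixing 0 that map the last indices onto J. Taking J in
    increasing order makes the dual minor 1 rather than a sign; the default is not reached for
    admissible J. *)
Definition sec (J : {set 'I_n}) : 'S_n := odflt 1%g [pick s | sec_pred J s].

Lemma sec_exists J : @Iadm n t J -> exists s, sec_pred J s.
Proof.
move=> hJ; have Jt := Iadm_card hJ; have J0 := Iadm_0 hJ.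
have [t0 tn] := andP ht.
(* The permutation is read off the list [L]: first 0, then the other indices outside J, and J in the
   last positions. *)
pose L1 := ord0 :: enum (~: (ord0 |: J)); pose L := L1 ++ enum J.
have Jn : (#|J| < n)%N by rewrite Jt.
have sL1 : size L1 = (n - #|J|)%N.
  by rewrite /= -cardE cardsCs setCK cardsU1 J0 card_ord add1n subnSK.
have sL : size L = n by rewrite size_cat sL1 -cardE subnK // ltnW.
have uL : uniq L.
  rewrite cat_uniq /= !enum_uniq andbT mem_enum !inE eqxx /= andbT.
  apply/hasPn => v; rewrite mem_enum inE mem_enum !inE => vJ.
  by rewrite vJ orbT orbF /=; apply: contraNneq J0 => <-.
have inj : injective (fun i : 'I_n => nth ord0 L i).
  by move=> i j /eqP; rewrite nth_uniq ?sL // => /eqP/ord_inj.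
exists (perm inj); rewrite /sec_pred permE /=; apply/forallP => a.
rewrite permE val_lrow ?(ltnW Jn) // nth_cat sL1 ltnNge leq_addr /= addKn.
by rewrite (enum_val_nth ord0).
Qed.

Lemma secP J : @Iadm n t J -> [/\ sec J ord0 = ord0,
   forall a : 'I_#|J|, sec J (lrow m a) = enum_val a &
   forall i : 'I_n, (n - t <= i)%N = (sec J i \in J)].
Proof.
move=> hJ; have Jt := Iadm_card hJ; have [t0 tn] := andP ht.
have [s0 hs0] := sec_exists hJ.
rewrite /sec; case: pickP => [s /andP[/eqP e0 /forallP ea] /=|/(_ s0)]; last by rewrite hs0.
have sE (a : 'I_#|J|) : s (lrow m a) = enum_val a by apply/eqP; exact: ea.
split=> // i; apply/idP/idP => hi.
  have ai : (i - (n - t) < #|J|)%N by rewrite Jt; have := ltn_ord i; lia.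
  have -> : i = lrow m (Ordinal ai).
    by apply: ord_inj; rewrite val_lrow /= Jt ?(ltnW tn) // subnKC.
  by rewrite sE enum_valP.
have -> : i = lrow m (enum_rank_in hi (s i)).
  by apply: (@perm_inj _ s); rewrite sE enum_rankK_in.
by rewrite val_lrow ?Jt ?(ltnW tn) // -Jt leq_addr.
Qed.

Lemma perm_col0 s i : s ord0 = ord0 -> (perm_mx s : 'M[k]_n) i ord0 = (i == ord0)%:R.
Proof. by move=> s0; rewrite !mxE -{1}s0 (inj_eq perm_inj). Qed.

(** H at the conjugate is the permutation matrix of [sec J]. Its minor on the columns of I is the
    identity if I = J; otherwise an element of I outside J gives a zero column. *)
Lemma ev_u_sec x I J : @Iadm n t I -> @Iadm n t J -> horner_mx_basis x = 1%:M ->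
  ev (cj (perm_mx (sec J)) x) (u_ k I) = (I == J)%:R.
Proof.
move=> hI hJ Hx; have [s0 sJ inJ] := secP hJ.
have E : horner_mx_basis (cj (perm_mx (sec J)) x) = perm_mx (sec J).
  have up : perm_mx (sec J) \in @unitmx k n by rewrite unitmx_perm.
  have := H_intertwine up (cj_mul x up).
  rewrite Hx mulmx1 perm_col0 // eqxx scale1r; apply => i i0.
  by rewrite perm_col0 // (negPf i0).
rewrite ev_u E; case: eqP => [->|/eqP ne].
  rewrite -[RHS](det1 _ #|J|); congr (\det _); apply/matrixP => a b.
  by rewrite !mxE sJ (inj_eq enum_val_inj).
have [b bI bJ] : exists2 b, b \in I & b \notin J.
  apply/subsetPn; apply: contra ne => IJ.
  by rewrite eqEcard IJ (Iadm_card hI) (Iadm_card hJ) leqnn.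
rewrite (expand_det_col _ (enum_rank_in bI b)) big1 // => a _.
rewrite mxE enum_rankK_in // perm_mxE; case: eqP => [e|]; last by rewrite mul0r.
case/negP: bJ; rewrite -e -inJ val_lrow; first by rewrite -(Iadm_card hI) leq_addr.
by rewrite (Iadm_card hI); case/andP: ht => _ /ltnW.
Qed.

(** By [adjcS] the vector e_j is carried to c_(j+1) e_0 - x e_j = e_(j+1). The hypothesis on [esymm]
    is met by conjugacy in [cyclic_normal_form] and by triangularity for c = 0, which avoids a
    general companion determinant. *)
Lemma H_companion_id (c : nat -> k) :
  (forall j, esymm (companion m c) j.+1 = c j.+1) ->
  horner_mx_basis (companion m c) = 1%:M.
Proof.
move=> hc; set x := companion m c.
have H j : (j < n)%N -> forall i : 'I_n, adjc x j i ord0 = (i == j :> nat)%:R.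
  elim: j => [|j IH] hj i; first by rewrite adjc0 mxE.
  have NE (A B : 'M[k]_n) : (A - B) i ord0 = A i ord0 - B i ord0 by rewrite !mxE.
  rewrite adjcS NE [(_)%:M _ _]mxE mxE (bigD1 (Ordinal (ltnW hj))) //= big1.
    rewrite (IH (ltnW hj)) eqxx mulr1 addr0 mxE hc /=.
    by case: eqP => _; rewrite ?mulr1n ?mulr0n opprB addrC ?subrK // subr0.
  move=> l lj; rewrite (IH (ltnW hj)).
  by rewrite -(inj_eq val_inj) /= in lj; rewrite (negPf lj) mulr0.
by apply/matrixP => i j; rewrite HE H // mxE.
Qed.

Definition horner_det : kg := \det (\matrix_(i, j) adjc (Defs.genmx k n) j i ord0 : 'M[kg]_n).

Lemma ev_horner_det x : ev x horner_det = \det (horner_mx_basis x).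
Proof.
rewrite -det_map_mx; congr (\det _); apply/matrixP => i j.
by rewrite mxE [in LHS]mxE HE -ev_adjc [RHS]mxE.
Qed.

(** Its value is 1 at the nilpotent companion matrix. *)
Lemma horner_det_neq0 : horner_det != 0.
Proof.
pose x := companion m (fun=> 0 : k).
suff hx : ev x horner_det = 1.
  by apply: contra_eq_neq hx => ->; rewrite linear0 eq_sym oner_neq0.
rewrite ev_horner_det H_companion_id ?det1 // => j; rewrite esymm.unlock det_trig.
  rewrite big1 ?coef1 // => i _; rewrite !mxE eqxx ltn_eqF // if_same subr0.
  by rewrite polyC0 mulr0 addr0.
apply/is_trig_mxP => i l il; rewrite !mxE if_same (ltn_eqF (ltnW _)) ?ltnS //.
by rewrite subr0 polyC0 mulr0 addr0 -(inj_eq val_inj) /= ltn_eqF.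
Qed.

(** The product of [f] with [horner_det] vanishes at every matrix, and k[g] is a domain. *)
Lemma eq0_generic f : (forall y, \det (horner_mx_basis y) != 0 -> ev y f = 0) -> f = 0.
Proof.
move=> h; have : f * horner_det = 0.
  apply: ev_inj => y; rewrite rmorphM rmorph0 /= ev_horner_det.
  by have [->|/h ->] := eqVneq (\det (horner_mx_basis y)) 0; rewrite ?mulr0 ?mul0r.
by move/eqP; rewrite mulf_eq0 (negPf horner_det_neq0) orbF => /eqP.
Qed.

Lemma cyclic_normal_form y : \det (horner_mx_basis y) != 0 ->
  let c := companion m (esymm y) in
  [/\ cj (horner_mx_basis y) c = y, esymm c =1 esymm y & horner_mx_basis c = 1%:M].
Proof.
move=> dy c; have uH : horner_mx_basis y \in unitmx by rewrite unitmxE unitfE.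
have e := H_companion y; have eC : esymm c =1 esymm y.
  by move=> i; rewrite (esymm_intertwine uH e).
split=> //; first by rewrite /cj -e mulmxK.
by apply: H_companion_id => j; rewrite -/c eC.
Qed.

Lemma G_invE f : G_inv f <-> forall g x, g \in unitmx -> ev (cj g x) f = ev x f.
Proof.
split=> [fG g x ug|h g ug].
  by rewrite ev_cj -act_gact fG // /in_G unitmx_inv.
rewrite act_gact; apply: ev_inj => x; rewrite -[g]invmxK -ev_cj h //.
by rewrite unitmx_inv.
Qed.

(** The restriction of f to the [sec J] conjugate of a companion section of the map y |-> (s_j(y)):
    only the s_j enter, which makes it G-invariant. By [ev_u_sec] it is the candidate for the
    coefficient of u_J. *)
Definition u_coef f (J : {set 'I_n}) : kg :=
  pull (map_mx (fun c => c%:MP) (perm_mx (sec J) : 'M[k]_n) *m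
        (\matrix_(i, j) ((if i == ord0 then Defs.s k n j.+1 else 0) - (i == j.+1 :> nat)%:R)) *m
        map_mx (fun c => c%:MP) (invmx (perm_mx (sec J)))) f.

Lemma ev_u_coef f J y :
  ev y (u_coef f J) = ev (cj (perm_mx (sec J)) (companion m (esymm y))) f.
Proof.
rewrite ev_pull !map_mxM !map_evC /cj; congr (ev (_ *m _ *m _) f).
apply/matrixP => i j; rewrite mxE [in LHS]mxE [RHS]mxE rmorphB rmorph_nat.
by congr (_ - _); case: ifP => _; rewrite ?rmorph0 //= ev_s.
Qed.

Lemma esymm_cj g y : g \in unitmx -> esymm (cj g y) =1 esymm y.
Proof. by move=> ug; apply: esymm_intertwine ug (cj_mul y ug). Qed.

Lemma companion_ext (c d : nat -> k) : c =1 d -> companion m c = companion m d.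
Proof. by move=> e; apply/matrixP => i j; rewrite !mxE e. Qed.

Lemma u_coef_G_inv f J : G_inv (u_coef f J).
Proof.
apply/G_invE => g x ug; rewrite !ev_u_coef; congr (ev (cj _ _) f).
exact/companion_ext/esymm_cj.
Qed.

(** The difference of the two sides is a highest weight vector that vanishes at the [sec J]
    conjugates of the companion form, hence at all permutations fixing 0 by [vanishing_block_perm],
    hence at y = H(y) C H(y)^-1 by [vanishing_spreads], as H(y) has first column e_0. Such y are
    generic. *)
Lemma u_span f : U_inv_wt lam f ->
  f = \sum_(J | @Iadm n t J) u_coef f J * u_ k J.
Proof.
move=> fU; apply/eqP; rewrite -subr_eq0; apply/eqP; set f' := _ - _.
have f'U : U_inv_wt lam f'.
  apply/B_semi_invE => g gB; rewrite act_gact linearB /= (U_inv_wtB fU gB).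
  rewrite scalerBr linear_sum scaler_sumr; congr (_ - _); apply: eq_bigr => J hJ.
  rewrite rmorphM /= -!act_gact (u_B_semi_inv ht hJ) // scalerAr.
  by rewrite u_coef_G_inv //; case: gB.
have up s : perm_mx s \in @unitmx k n by rewrite unitmx_perm.
apply: eq0_generic => y dy; have [ey eC HC] := cyclic_normal_form dy.
rewrite -ey; apply: (vanishing_spreads f'U) => [s s0||i].
(* The image under s of the last t indices, so that s and [sec J] are related by
   [vanishing_block_perm]. *)
- pose J := [set v | (n - t <= (s^-1)%g v)%N].
  have hJ : @Iadm n t J.
    have [t0 tn] := andP ht; apply/andP; split.
      apply/'forall_implyP => v; rewrite inE lt0n; apply: contraTneq => v0.
      rewrite (_ : (s^-1)%g v = ord0) -?ltnNge ?subn_gt0 //.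
      by apply: (@perm_inj _ s); rewrite permKV s0; apply: ord_inj.
    rewrite -(card_imset _ (@perm_inj _ (s^-1)%g)).
    rewrite (_ : _ @: _ = [set i : 'I_n | (n - t <= i)%N]); last first.
      apply/setP => i; rewrite !inE; apply/imsetP/idP => [[v]|hi].
        by rewrite inE => hv ->.
      by exists (s i); rewrite ?inE permK.
    by rewrite cardsE -sum1_card (big_lrow _ (fun=> 1%N)) ?t0 1?ltnW // sum1_card card_ord.
  have [sec0 _ inJ] := secP hJ.
  apply: (vanishing_block_perm (r := sec J) f'U s0 sec0) => [v|].
    by rewrite (inJ ((sec J)^-1 v)%g) permKV inE.
  rewrite linearB linear_sum /= (bigD1 J) //= big1 ?addr0 => [|I /andP[hI IJ]].
    rewrite rmorphM /= ev_u_sec // eqxx mulr1 ev_u_coef.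
    rewrite (companion_ext (d := esymm y)) ?subrr // => i.
    by rewrite esymm_cj.
  by rewrite rmorphM /= ev_u_sec // (negPf IJ) mulr0.
- by rewrite unitmxE unitfE.
- by rewrite H_col0.
Qed.

(** Evaluating the relation at the [sec J] conjugate of the companion form of y isolates c_J, whose
    value there is c_J(y) by invariance. *)
Lemma u_free (c : {set 'I_n} -> kg) : (forall J, G_inv (c J)) ->
  \sum_(J | @Iadm n t J) c J * u_ k J = 0 -> forall J, @Iadm n t J -> c J = 0.
Proof.
move=> cG c0 J hJ; apply: eq0_generic => y dy.
have [ey eC HC] := cyclic_normal_form dy.
have up s : perm_mx s \in @unitmx k n by rewrite unitmx_perm.
have := congr1 (ev (cj (perm_mx (sec J)) (companion m (esymm y)))) c0.
rewrite rmorph0 rmorph_sum /= (bigD1 J) //= big1 ?addr0 => [|I /andP[hI IJ]].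
  rewrite rmorphM /= ev_u_sec // eqxx mulr1 => <-.
  have /G_invE h := cG J; rewrite h // -[in LHS]ey h //.
  by rewrite unitmxE unitfE.
by rewrite rmorphM /= ev_u_sec // (negPf IJ) mulr0.
Qed.

Lemma u_module_basis :
  module_basis (@G_inv k n) (@U_inv_wt k n lam) (@Iadm n t) (@u_ k n).
Proof.
split=> [J hJ|f fU|]; last exact: u_free.
  exact/B_semi_invE/u_B_semi_inv.
by exists (u_coef f); split; [exact: u_coef_G_inv | exact: u_span].
Qed.

End Weight.

(** * Factors of highest weight vectors *)

Lemma monomial_factor (R : idomainType) (P Q : {poly R}) (f : R) N :
  f != 0 -> P * Q = f *: 'X^N -> exists e a, P = a *: 'X^e.
Proof.
move=> f0 PQ.
have PQ0 : P * Q != 0 by rewrite PQ -mul_polyC mulf_neq0 ?polyC_eq0 // monic_neq0 ?monicXn.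
have [P0 Q0] : P != 0 /\ Q != 0 by move: PQ0; rewrite mulf_eq0 negb_or => /andP.
have [d [P1 rP1 eP]] := multiplicity_XsubC P 0.
have [r [Q1 rQ1 eQ]] := multiplicity_XsubC Q 0.
move: rP1 rQ1; rewrite P0 Q0 /= /root => rP1 rQ1.
rewrite subr0 in eP eQ.
have Xn0 j : 'X^j != 0 :> {poly R} by rewrite monic_neq0 ?monicXn.
have z0 : (P1 * Q1).[0] != 0 by rewrite hornerM mulf_neq0.
have E : P1 * Q1 * 'X^(d + r) = f *: 'X^N by rewrite -PQ exprD mulrACA -eP -eQ.
(* Neither cofactor vanishes at 0, so after cancelling powers of X the values at 0 force d + r =
   N. *)
have [lt|gt|eN] := ltngtP (d + r)%N N.
- rewrite -(subnK (ltnW lt)) [in RHS]exprD scalerAl in E.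
  have {}E := mulIf (Xn0 _) E.
  by move: z0; rewrite E hornerZ hornerXn expr0n subn_eq0 leqNgt lt mulr0 eqxx.
- rewrite -(subnK (ltnW gt)) [in LHS]exprD mulrA -mul_polyC in E.
  have := congr1 (horner^~ 0) (mulIf (Xn0 _) E).
  rewrite hornerM hornerXn expr0n subn_eq0 leqNgt gt mulr0 hornerC => /esym/eqP.
  by rewrite (negPf f0).
have E1 : P1 * Q1 = f%:P.
  by rewrite eN -mul_polyC in E; apply: mulIf E.
have P10 : P1 != 0 by apply: contraNneq P0 => e; rewrite eP e mul0r.
have Q10 : Q1 != 0 by apply: contraNneq Q0 => e; rewrite eQ e mul0r.
have := congr1 (fun p : {poly R} => size p) E1; rewrite size_mul // size_polyC f0 /= => s1.
exists d, P1`_0; rewrite {1}eP -mul_polyC -size1_polyC //.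
move: Q10 s1; rewrite -size_poly_gt0.
by case: (size Q1) => // q _; rewrite addnS => <-; rewrite leq_addr.
Qed.

Section Factors.
Variables (k : closedFieldType) (n : nat).
Local Notation kg := {mpoly k[n * n]}.
Implicit Types (f a b : kg) (g u x : 'M[k]_n) (lam : 'I_n -> int).

(** The line through 1 and u lies in U. Along it the translates of a and b are polynomials in c with
    product the nonzero constant f, so both are constant; c = 0 and c = 1 give the claim. *)
Lemma U_inv_factor lam f a b : f != 0 -> U_inv_wt lam f -> f = a * b ->
  forall u, in_U u -> gact u a = a.
Proof.
move=> f0 fU fab u uU.
pose w c : 'M[k]_n := 1%:M + c *: (u - 1%:M).
have wE c i j : w c i j = (i == j)%:R + c * (u i j - (i == j)%:R) by rewrite !mxE.
have wU c : in_U (w c).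
  case: uU => u1 u0; split=> [i|i j ji]; rewrite wE ?u1 ?u0 //.
    by rewrite eqxx subrr mulr0 addr0.
  by rewrite -(inj_eq val_inj) /= gtn_eqF // subr0 mulr0 addr0.
have Qw i j : polyfun (fun c => (w c i j)%:MP : kg).
  apply: (fr_ext (polyfun_ring k n)
    (h1 := fun c => (i == j)%:R%:MP + c%:MP * (u i j - (i == j)%:R)%:MP)).
    by move=> c; rewrite wE [in RHS]mpolyCD [in RHS]mpolyCM.
  apply: (fr_add (polyfun_ring k n)); first exact: (fr_cst (polyfun_ring k n)).
  by apply: (fr_mul (polyfun_ring k n)); [exact: polyfun_var | exact: (fr_cst (polyfun_ring k n))].
(* The determinant is 1 along the line, so the inverse is the adjugate and is polynomial in c. *)
have Qi i j : polyfun (fun c => (invmx (w c) i j)%:MP : kg).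
  pose W c : 'M[kg]_n := map_mx (@mpolyC (n * n) k) (w c).
  apply: (fr_ext (polyfun_ring k n) (h1 := fun c => (\adj (W c)) i j)).
    move=> c; rewrite (@invmx_eq k n _ (\adj (w c))); last first.
      by rewrite mul_adj_mx in_U_det.
    by rewrite /W -map_mx_adj mxE.
  apply: (fr_adj (polyfun_ring k n)) => p q.
  by apply: (fr_ext (polyfun_ring k n) _ (Qw p q)) => c; rewrite [RHS]mxE.
have [A hA] := fr_gact (polyfun_ring k n) a Qw Qi.
have [B hB] := fr_gact (polyfun_ring k n) b Qw Qi.
have E : A * B = f%:P.
  apply: mpoly_poly_eq => c _; rewrite hornerM -hA -hB -rmorphM -fab hornerC.
  exact: U_inv_wtU fU (wU c).
have A0 : A != 0 by apply: contra_neq f0 => A0; apply/polyC_inj; rewrite -E A0 mul0r.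
have B0 : B != 0 by apply: contra_neq f0 => B0; apply/polyC_inj; rewrite -E B0 mulr0.
have := congr1 (fun p : {poly kg} => size p) E; rewrite size_mul // size_polyC f0 /= => s1.
have sA : (size A <= 1)%N.
  move: B0 s1; rewrite -size_poly_gt0.
  by case: (size B) => // q _; rewrite addnS => <-; rewrite leq_addr.
have w0 : w 0 = 1%:M by rewrite /w scale0r addr0.
have w1 : w 1 = u by rewrite /w scale1r addrC subrK.
by rewrite -[in RHS](act1 a) -w0 -w1 !hA (size1_polyC sA) !hornerC.
Qed.

Definition one_param (i : 'I_n) (z : k) : 'M[k]_n :=
  diag_mx (\row_j (if j == i then z else 1)).

Lemma one_param_in_T i z : z != 0 -> in_T (one_param i z).
Proof.
by move=> z0; apply: diag_in_T => j; rewrite mxE; case: ifP => _ //; rewrite oner_neq0.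
Qed.

Lemma one_paramE i z p q :
  one_param i z p q = (if p == i then z else 1) *+ (p == q).
Proof. by rewrite !mxE. Qed.

Lemma chr_one_param lam i z : chr lam (one_param i z) = z ^ lam i.
Proof.
rewrite /chr (bigD1 i) //= big1 => [|j ji]; rewrite one_paramE eqxx mulr1n.
  by rewrite mulr1.
by rewrite (negPf ji) exp1rz.
Qed.

Lemma laurent_one_param f i : laurent (fun z => gact (one_param i z) f).
Proof.
have LR := laurent_ring k n.
apply: (fr_gact LR) => p q.
  apply: (fr_ext LR (h1 := fun z => if p == q then if p == i then z%:MP else 1 else 0)).
    move=> z; rewrite one_paramE; case: (p == q); case: (p == i);
      by rewrite /= ?mpolyC0 ?mpolyC1.
  case: (p == q); last exact: (fr_cst LR).
  by case: (p == i); [exact: laurent_var | exact: (fr_cst LR)].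
have L : laurent (fun z => if p == q then if p == i then z^-1%:MP else 1 else 0 : kg).
  case: (p == q); last exact: (fr_cst LR).
  by case: (p == i); [exact: laurent_inv | exact: (fr_cst LR)].
case: L => N [P hP]; exists N, P => z z0; rewrite -hP //; congr (_ *: _).
rewrite (@invmx_eq k n _ (one_param i z^-1)).
  rewrite one_paramE; case: (p == q); case: (p == i);
    by rewrite /= ?mpolyC0 ?mpolyC1.
rewrite mulmx_diag -diag_const_mx; congr diag_mx; apply/rowP => j; rewrite !mxE.
by case: ifP => _; rewrite ?mulVf ?mulr1.
Qed.

(** After clearing poles, the translates of a and b multiply to a monomial in z times f. Each is
    then a monomial by [monomial_factor], and z = 1 identifies its coefficient with a. *)
Lemma one_param_weight lam f a b i : f != 0 -> U_inv_wt lam f -> f = a * b ->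
  exists e : int, forall z, z != 0 -> gact (one_param i z) a = z ^ e *: a.
Proof.
move=> f0 fU fab.
have [N [P hP]] := laurent_one_param a i.
have [M [Q hQ]] := laurent_one_param b i.
have E z : z != 0 -> (P * Q).[z%:MP] = (z ^+ (N + M) * z ^ lam i) *: f.
  move=> z0; rewrite hornerM -hP // -hQ // -scalerAl -scalerAr scalerA -exprD.
  rewrite -(rmorphM (gact (one_param i z))) -fab /= (U_inv_wtB fU (in_T_in_B (one_param_in_T i z0))).
  by rewrite chr_one_param scalerA.
have [e [a' eP]] : exists e a', P = a' *: 'X^e.
  (* The weight may be negative; a further factor X^L makes the exponent a natural number. *)
  have [L [L' eL]] : exists L L' : nat, lam i + L = L'.
    by case: (lam i) => p; [exists 0%N, p; rewrite addr0 | exists p.+1, 0%N; rewrite NegzE addNr].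
  apply: (@monomial_factor _ _ (Q * 'X^L) f (N + M + L')) => //.
  apply: mpoly_poly_eq => z z0; rewrite mulrA hornerM E // hornerZ !hornerXn -!mpolyCX.
  rewrite ![_ * _%:MP]mulrC !mul_mpolyC scalerA; congr (_ *: _).
  rewrite [in RHS]exprD -[z ^+ L']/(z ^ (L' : int)) -eL expfzDr //.
  by rewrite -[z ^ (L : int)]/(z ^+ L); ring.
have hz z : z != 0 -> z ^+ N *: gact (one_param i z) a = z ^+ e *: a'.
  by move=> z0; rewrite hP // eP hornerZ hornerXn -mpolyCX mulrC mul_mpolyC.
have a'E : a' = a.
  have := hz 1 (oner_neq0 _); rewrite !expr1n !scale1r => <-.
  rewrite (_ : one_param i 1 = 1%:M) ?act1 //.
  by apply/matrixP => p q; rewrite one_paramE if_same mxE.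
exists (e%:Z - N%:Z) => z z0; have zN : z ^+ N != 0 by rewrite expf_neq0.
apply: (scalerI zN); rewrite hz // a'E scalerA; congr (_ *: _).
by rewrite expfzDr // mulrCA -exprnN mulfV // mulr1.
Qed.

Lemma T_weight_factor lam f a b : f != 0 -> U_inv_wt lam f -> f = a * b ->
  exists e : 'I_n -> int, U_inv_wt e a.
Proof.
move=> f0 fU fab.
have [e he] := fin_all_exists (fun i => one_param_weight i f0 fU fab).
exists e; split=> [u uU|t tT]; rewrite act_gact; first exact: U_inv_factor f0 fU fab u uU.
have t0 i : t i i != 0 by apply/in_B_diag/in_T_in_B.
(* [D r] keeps the entries of t indexed by r, so t is built up one factor [one_param] at a time. *)
pose D (r : seq 'I_n) : 'M[k]_n := diag_mx (\row_j (if j \in r then t j j else 1)).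
have hD r : uniq r -> gact (D r) a = (\prod_(i <- r) t i i ^ e i) *: a.
  elim: r => [_|i r IH /= /andP[ir ur]].
    rewrite big_nil scale1r (_ : D [::] = 1%:M) ?act1 //.
    by apply/matrixP => p q; rewrite !mxE.
  have -> : D (i :: r) = one_param i (t i i) *m D r.
    rewrite mulmx_diag; congr diag_mx; apply/rowP => j; rewrite !mxE inE.
    by have [->|] := eqVneq j i; rewrite ?(negPf ir) ?mulr1 ?mul1r.
  have Du : D r \in unitmx.
    by apply: (proj1 (diag_in_T _)) => j; rewrite mxE; case: ifP => _; rewrite ?t0 ?oner_neq0.
  rewrite actM //; last by case: (one_param_in_T i (t0 i)).
  by rewrite IH // linearZ /= he // scalerA big_cons mulrC.
have -> : t = D (index_enum 'I_n).
  apply/matrixP => p q; rewrite !mxE mem_index_enum.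
  by case: eqP => [->|/eqP pq] //; case: tT => _ ->.
rewrite hD ?index_enum_uniq //; congr (_ *: _); apply: eq_bigr => i _.
by rewrite !mxE eqxx mem_index_enum.
Qed.

Lemma exprz_eq1_all (e : int) : (forall z : k, z != 0 -> z ^ e = 1) -> e = 0.
Proof.
suff pos (p : nat) : (forall z : k, z != 0 -> z ^+ p = 1) -> p = 0%N.
  case: e => p h; first by rewrite (pos p).
  suff : p.+1 = 0%N by [].
  apply: pos => z z0; have := h _ z0; rewrite NegzE -exprnN.
  by move=> /(congr1 GRing.inv); rewrite invrK invr1.
case: p => // p h; have : 'X^(p.+1) - 1 = 0 :> {poly k}.
  apply: (poly_eq0_nonzero_points (i := idfun)) => z z0.
  by rewrite hornerD hornerN hornerXn hornerC h // subrr.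
by move/eqP; rewrite -size_poly_eq0 size_XnsubC.
Qed.

(** Scalar matrices act trivially by conjugation. *)
Lemma weight_sum0 lam f : f != 0 -> U_inv_wt lam f -> \sum_i lam i = 0.
Proof.
move=> f0 fU; apply: exprz_eq1_all => z z0.
have zT : in_T (z%:M : 'M[k]_n).
  rewrite -diag_const_mx; apply: diag_in_T => i; by rewrite mxE.
have inv : gact (z%:M : 'M[k]_n) f = f.
  apply: ev_inj => x; rewrite ev_act -mulmxA mul_mx_scalar -mul_scalar_mx mulmxA.
  by rewrite mulVmx ?mul1mx //; case: zT.
have := U_inv_wtB fU (in_T_in_B zT); rewrite inv => e.
have {}e : (chr lam (z%:M) - 1) *: f = 0 by rewrite scalerBl -e scale1r subrr.
move/eqP: e; rewrite scaler_eq0 (negPf f0) orbF subr_eq0 => /eqP <-.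
rewrite /chr; under eq_bigr do rewrite mxE eqxx mulr1n.
by elim/big_rec2: _ => [|i p s _ <-]; rewrite ?expr0z // expfzDr.
Qed.

Lemma weight_unique lam mu f : f != 0 -> U_inv_wt lam f -> U_inv_wt mu f -> lam =1 mu.
Proof.
move=> f0 fl fm i; apply/eqP; rewrite -subr_eq0; apply/eqP/exprz_eq1_all => z z0.
have tB := in_T_in_B (one_param_in_T i z0).
have := U_inv_wtB fl tB; rewrite (U_inv_wtB fm tB) !chr_one_param => e.
have {}e : (z ^ lam i - z ^ mu i) *: f = 0 by rewrite scalerBl e subrr.
move/eqP: e; rewrite scaler_eq0 (negPf f0) orbF subr_eq0 => /eqP e.
by rewrite expfzDr // e -expfzDr // subrr.
Qed.

Lemma U_inv_wtM lam mu a b : U_inv_wt lam a -> U_inv_wt mu b ->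
  U_inv_wt (fun i => lam i + mu i) (a * b).
Proof.
move=> /[dup] al /B_semi_invE aB /[dup] bm /B_semi_invE bB; apply/B_semi_invE => g gB.
rewrite act_gact rmorphM /= (U_inv_wtB al) // (U_inv_wtB bm) //.
rewrite -scalerAl -scalerAr scalerA /chr -big_split /=; congr (_ *: _).
by apply: eq_bigr => i _; rewrite expfzDr // in_B_diag.
Qed.

(** Upper transvections fix f by U-invariance, lower ones by [lower_equal_weights], diagonal
    matrices by weight 0; these generate G. *)
Lemma weight0_G_inv lam f : U_inv_wt lam f -> lam =1 (fun=> 0) -> G_inv f.
Proof.
move=> fU l0 g ug; rewrite act_gact.
pose K (h : 'M[k]_n) := h \in unitmx /\ gact h f = f.
suff [] : K g by [].
apply: elementary_generation ug; last by rewrite /K unitmx1 act1.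
split=> [i j c h ij _ [uh Kh]|d h d0 [uh Kh]]; split.
- by rewrite unitmx_mul transv_unit.
- rewrite actM ?transv_unit // Kh; case: (ltngtP i j) => [lt|lt|/ord_inj e].
  + exact: U_inv_wtU fU (transv_in_U _ lt).
  + by apply: (lower_equal_weights fU lt _).1; rewrite !l0.
  + by rewrite e eqxx in ij.
- by rewrite unitmx_mul uh andbT; case: (diag_in_T d0).
- have dT := diag_in_T d0; rewrite actM ?(proj1 dT) // Kh.
  rewrite (U_inv_wtB fU (in_T_in_B dT)) /chr big1 ?scale1r // => i _.
  by rewrite l0 expr0z.
Qed.

End Factors.

(** * Irreducibility of the combinations of the u *)

Section Irreducible.
Variables (k : closedFieldType) (m t : nat).
Local Notation n := m.+1.
Hypothesis (ht : (0 < t < n)%N).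
Local Notation kg := {mpoly k[n * n]}.
Local Notation lam := (@lam_ n t).
Implicit Types (f a b : kg).

(** The last entry is the least one, and the entries sum to 0. *)
Lemma dominant_last0 (e : 'I_n -> int) :
  (forall i j : 'I_n, (i < j)%N -> e j <= e i) -> \sum_i e i = 0 ->
  e ord_max <= 0 /\ (e ord_max = 0 -> e =1 (fun=> 0)).
Proof.
move=> dec e0; have lst i : e ord_max <= e i.
  have [->//|ne] := eqVneq i ord_max; apply: dec.
  by rewrite ltn_neqAle -(inj_eq val_inj) in ne *; rewrite ne -ltnS /=.
split=> [|l0].
  rewrite leNgt; apply/negP => pos; have : 0 < \sum_i e i.
    rewrite (bigD1 ord_max) //= ltr_wpDr // sumr_ge0 // => i _.
    exact: le_trans (ltW pos) (lst i).
  by rewrite e0 ltxx.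
have nn i : true -> 0 <= e i by move=> _; rewrite -l0.
by move=> i; apply: (psumr_eq0P nn e0).
Qed.

Lemma G_invM a b : G_inv a -> G_inv b -> G_inv (a * b).
Proof. by move=> ha hb g ug; rewrite act_gact rmorphM /= -!act_gact ha // hb. Qed.

Lemma G_invB a b : G_inv a -> G_inv b -> G_inv (a - b).
Proof. by move=> ha hb g ug; rewrite act_gact rmorphB /= -!act_gact ha // hb. Qed.

Lemma G_invC (c : k) : G_inv (c%:MP : kg).
Proof. by move=> g ug; rewrite act_gact actC. Qed.

Variable c : {set 'I_n} -> k.
Hypothesis c_neq0 : exists I, @Iadm n t I /\ c I != 0.
Local Notation f := (\sum_(I | @Iadm n t I) c I *: u_ k I).

Lemma u_comb_B_semi_inv : B_semi_inv lam f.
Proof.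
move=> g gB; rewrite act_gact linear_sum scaler_sumr; apply: eq_bigr => I hI.
by rewrite linearZ /= -act_gact (u_B_semi_inv ht hI gB) !scalerA mulrC.
Qed.

(** Writing b = sum b_J u_J, freeness gives a b_J = c_J for every J; some c_I is a nonzero scalar,
    so a is invertible. *)
Lemma G_inv_factor_unit a b : f = a * b -> G_inv a -> U_inv_wt lam b ->
  a \is a GRing.unit.
Proof.
move=> fab aG /(u_span ht) bE; case: c_neq0 => I [hI cI].
have := u_free ht (c := fun J => a * u_coef b J - (c J)%:MP).
move=> /(_ _ _ _ hI) E.
apply/unitrPr; exists (u_coef b I * (c I)^-1%:MP).
rewrite mulrA (_ : a * _ = (c I)%:MP); first by rewrite -mpolyCM mulfV.
apply/eqP; rewrite -subr_eq0; apply/eqP; apply: E.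
  by move=> J; apply: G_invB (G_invC _); apply: G_invM => //; apply: u_coef_G_inv.
under eq_bigr do rewrite mulrBl -mulrA mul_mpolyC.
by rewrite big_split /= sumrN -big_distrr /= -bE -fab subrr.
Qed.

Lemma u_comb_neq0 : f != 0.
Proof.
case: c_neq0 => I [hI cI]; apply: contra cI => /eqP f0.
have := u_free ht (c := fun J => (c J)%:MP) (fun J => G_invC _).
under eq_bigr do rewrite mul_mpolyC.
by move=> /(_ f0 _ hI) /eqP; rewrite mpolyC_eq0.
Qed.

Lemma u_comb_irreducible : irreducible_elt f.
Proof.
have f0 := u_comb_neq0; have fB := u_comb_B_semi_inv.
have /B_semi_invE fU := fB; split=> // [|a b fab].
  (* A unit has a nonzero value at the zero matrix, where f vanishes by [ev_u0]. *)
  apply/negP => /mulrV /(congr1 (ev 0)).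
  rewrite rmorph1 rmorphM /= linear_sum big1 ?mul0r => [/eqP|I hI].
    by rewrite eq_sym oner_eq0.
  by rewrite linearZ /= (ev_u0 _ _ hI) ?mulr0 //; case/andP: ht.
have fba : f = b * a by rewrite mulrC.
have /andP[a0 b0] : (a != 0) && (b != 0) by rewrite -negb_or -mulf_eq0 -fab.
have [ea aU] := T_weight_factor f0 fU fab.
have [eb bU] := T_weight_factor f0 fU fba.
have [la za] := dominant_last0 (fun i j => weight_dominant aU a0) (weight_sum0 a0 aU).
have [lb zb] := dominant_last0 (fun i j => weight_dominant bU b0) (weight_sum0 b0 bU).
have sum : lam =1 (fun i => ea i + eb i).
  by apply: weight_unique f0 fU _; rewrite fab; apply: U_inv_wtM.
have t0 : (0 < m)%N by case/andP: ht => t0 tm; lia.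
have last : ea ord_max + eb ord_max = -1.
  rewrite -sum lam_nz; last by rewrite -(inj_eq val_inj) /= -lt0n.
  by rewrite /= ifT //; case/andP: ht => t1 tm; lia.
have transfer (e1 e2 : 'I_n -> int) g : e1 =1 (fun=> 0) -> lam =1 (fun i => e1 i + e2 i) ->
    U_inv_wt e2 g -> U_inv_wt lam g.
  move=> z1 e12 [gU gT]; split=> // h hT; rewrite gT //; congr (_ *: _).
  by apply: eq_bigr => i _; rewrite e12 z1 add0r.
(* Two nonpositive integers with sum -1: one of them is 0. *)
have [ea0|eb0] : ea ord_max = 0 \/ eb ord_max = 0 by lia.
  left; apply: (G_inv_factor_unit fab); first exact: weight0_G_inv aU (za ea0).
  exact: transfer (za ea0) sum bU.
right; apply: (G_inv_factor_unit fba); first exact: weight0_G_inv bU (zb eb0).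
by apply: transfer (zb eb0) _ aU => i; rewrite sum addrC.
Qed.

End Irreducible.

(** * Transposition along the antidiagonal *)

Section Antitranspose.
Variables (k : closedFieldType) (n : nat).
Local Notation kg := {mpoly k[n * n]}.
Implicit Types (f a b : kg) (g x : 'M[k]_n) (lam : 'I_n -> int).

(** Unlike ordinary transposition, this antiautomorphism preserves upper triangular matrices. *)
Definition flip (R : Type) (x : 'M[R]_n) : 'M[R]_n :=
  \matrix_(i, j) x (rev_ord j) (rev_ord i).

Lemma flipK x : flip (flip x) = x.
Proof. by apply/matrixP => i j; rewrite !mxE !rev_ordK. Qed.

Lemma flipM g x : flip (g *m x) = flip x *m flip g.
Proof.
apply/matrixP => i j; rewrite !mxE (reindex_inj rev_ord_inj) /=.
by apply: eq_bigr => l _; rewrite !mxE mulrC.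
Qed.

Lemma flip_scalar (c : k) : flip c%:M = c%:M.
Proof. by apply/matrixP => i j; rewrite !mxE (inj_eq rev_ord_inj) eq_sym. Qed.

Lemma flipV g : g \in unitmx -> invmx (flip g) = flip (invmx g).
Proof. by move=> ug; apply: invmx_eq; rewrite -flipM mulmxV // flip_scalar. Qed.

Lemma flip_unit g : g \in unitmx -> flip g \in unitmx.
Proof.
move=> ug; have /mulmx1_unit [] // : flip g *m flip (invmx g) = 1%:M.
by rewrite -flipM mulVmx // flip_scalar.
Qed.

Lemma flip_in_B g : in_B g -> in_B (flip g).
Proof.
case=> ug g0; split; first exact: flip_unit.
by move=> i j ji; rewrite mxE g0 //=; have := ltn_ord i; lia.
Qed.

Definition tau f : kg := pull (flip (Defs.genmx k n)) f.

HB.instance Definition _ := GRing.RMorphism.copy tau (pull (flip (Defs.genmx k n))).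
HB.instance Definition _ := GRing.Linear.copy tau (pull (flip (Defs.genmx k n))).

Lemma ev_tau x f : ev x (tau f) = ev (flip x) f.
Proof.
rewrite ev_pull; congr (ev _ f); apply/matrixP => i j.
by rewrite [LHS]mxE [in LHS]mxE [RHS]mxE -[in RHS](map_ev_genmx x) [RHS]mxE.
Qed.

Lemma tauK f : tau (tau f) = f.
Proof. by apply: ev_inj => x; rewrite !ev_tau flipK. Qed.

Lemma gact_tau g f : g \in unitmx ->
  gact g (tau f) = tau (gact (invmx (flip g)) f).
Proof.
move=> ug; apply: ev_inj => x; rewrite ev_act !ev_tau -ev_cj /cj flipV //.
by rewrite !flipM mulmxA.
Qed.

Lemma tau_G_inv f : G_inv f -> G_inv (tau f).
Proof.
move=> fG g ug; rewrite act_gact gact_tau // -act_gact fG //.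
by rewrite /in_G unitmx_inv flip_unit.
Qed.

(** As [flip] reverses products, g acts on [tau f] through the inverse of [flip g]: the inverse
    negates the weight and the flip reverses it. *)
Lemma tau_weight lam mu f : (forall i, mu i = - lam (rev_ord i)) ->
  U_inv_wt lam f -> U_inv_wt mu (tau f).
Proof.
move=> ml fU; apply/B_semi_invE => g gB; rewrite act_gact gact_tau; last by case: gB.
rewrite (gact_invB fU (flip_in_B gB)) linearZ /=; congr (_ *: _).
rewrite /chr -prodfV (reindex_inj rev_ord_inj) /=; apply: eq_bigr => i _.
by rewrite mxE rev_ordK ml invr_expz.
Qed.

Lemma tau_irreducible f : irreducible_elt f -> irreducible_elt (tau f).
Proof.
case=> f0 fu firr; have tauU a : tau a \is a GRing.unit -> a \is a GRing.unit.
  by move=> /(rmorph_unit tau) /=; rewrite tauK.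
split=> [||a b e].
- by apply: contra f0 => /eqP e; rewrite -[f]tauK e raddf0.
- by apply: contra fu; apply: tauU.
have /firr [] : f = tau a * tau b by rewrite -rmorphM -e /= tauK.
  by move/tauU; left.
by move/tauU; right.
Qed.

(** The transpose of [flip x] is the conjugate of x by the order reversing permutation. *)
Lemma esymm_flip x : esymm (flip x) =1 esymm x.
Proof.
move=> i; rewrite -esymm_tr; pose W : 'M[k]_n := perm_mx (perm rev_ord_inj).
have uW : W \in unitmx by rewrite unitmx_perm.
apply: (esymm_intertwine uW); apply/matrixP => p q.
rewrite /W -row_permE [RHS]mxE permE [LHS]mxE (bigD1 (rev_ord q)) //= big1.
  by rewrite perm_mxE permE rev_ordK eqxx mulr1 addr0 !mxE rev_ordK.
move=> l lq; rewrite perm_mxE permE; case: eqP => [e|]; last by rewrite mulr0.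
by move: lq; rewrite -e rev_ordK eqxx.
Qed.

Lemma adjc_flip x j : adjc (flip x) j = flip (adjc x j).
Proof.
elim: j => [|j IH]; first by rewrite !adjc0 flip_scalar.
rewrite !adjcS esymm_flip IH -flipM -adjc_comm -{1}(flip_scalar (esymm x j.+1)).
by apply/matrixP => p q; rewrite !mxE.
Qed.

End Antitranspose.

(** * Transfer of the results to the v *)

Section VCase.
Variables (k : closedFieldType) (m t : nat).
Local Notation n := m.+1.
Hypothesis (ht : (0 < t < n)%N).
Local Notation kg := {mpoly k[n * n]}.

Definition rev_sign (N : nat) : k := (-1) ^+ (perm (@rev_ord_inj N)).

Lemma rev_signK N : rev_sign N * rev_sign N = 1.
Proof. by rewrite /rev_sign -signr_addb addbb. Qed.

(** The flip carries the last t rows of H to the first t row positions of the v minor in reverse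
    order, whence the sign. *)
Lemma v_tau_u I : @Iadm n t I -> v_ k I = rev_sign t *: tau (u_ k I).
Proof.
move=> hI; have It := Iadm_card hI; have [t0 tn] := andP ht.
have In : (#|I| <= n)%N by rewrite It ltnW.
rewrite -It; apply: ev_inj => x; rewrite linearZ /= ev_tau ev_u.
rewrite /rev_sign -det_perm -det_mulmx -row_permE -det_map_mx; congr (\det _).
apply/matrixP => a b; rewrite [LHS]mxE [in LHS]mxE /= [RHS]mxE [RHS]mxE permE HE adjc_flip.
rewrite [RHS]mxE !nat_ordE //; last exact: leq_trans (ltn_ord a) In.
rewrite ev_dxi_s; congr (adjc x _ _ _); apply: ord_inj.
  by rewrite inordK //= subn1.
rewrite inordK /=; last exact: leq_trans (ltn_ord a) In.
rewrite val_lrow //=.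
have E (N l : nat) : (l < N -> N <= n -> l = n - (n - N + (N - l.+1)).+1)%N by lia.
exact: E (ltn_ord a) In.
Qed.

Lemma mu_lam (i : 'I_n) : @mu_ n t i = - @lam_ n t (rev_ord i).
Proof.
rewrite /mu_ /lam_ /=; have [t0 tn] := andP ht; have li := ltn_ord i.
have -> : (n - i.+1 == 0)%N = (i == m :> nat) by apply/eqP/eqP; lia.
have -> : (n - t <= n - i.+1)%N = (i < t)%N by apply/idP/idP; lia.
have [im|] := eqVneq (i : nat) m; last by case: ifP; rewrite ?opprK ?oppr0.
by rewrite im ifF //; lia.
Qed.

Lemma lam_mu (i : 'I_n) : @lam_ n t i = - @mu_ n t (rev_ord i).
Proof. by rewrite mu_lam opprK rev_ordK. Qed.

(** [tau] is an involution that preserves G-invariants and exchanges the weights lambda^t and mu^t;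
    coefficients are carried over by [tau] and the sign. *)
Lemma v_module_basis :
  module_basis (@G_inv k n) (@U_inv_wt k n (@mu_ n t)) (@Iadm n t) (@v_ k n).
Proof.
have [uM uS uF] := u_module_basis k ht.
have scaleG (c : k) (a : kg) : G_inv a -> G_inv (c *: a).
  by move=> aG g ug; rewrite act_gact linearZ /= -act_gact aG.
split=> [J hJ|f fU|c cG c0 J hJ].
- have [vU vT] := tau_weight mu_lam (uM J hJ).
  rewrite v_tau_u //; split=> g hg; rewrite act_gact linearZ /= -act_gact.
    by rewrite vU.
  by rewrite vT // !scalerA mulrC.
- have [c [cG e]] := uS _ (tau_weight lam_mu fU).
  exists (fun J => rev_sign t *: tau (c J)); split=> [J|].
    exact/scaleG/tau_G_inv.
  rewrite -[f]tauK e rmorph_sum; apply: eq_bigr => J hJ.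
  by rewrite rmorphM /= v_tau_u // -scalerAl -scalerAr scalerA rev_signK scale1r.
have : \sum_(J | @Iadm n t J) (rev_sign t *: tau (c J)) * u_ k J = 0.
  transitivity (\sum_(I | @Iadm n t I) tau (c I * v_ k I)).
    2: by rewrite -rmorph_sum c0 rmorph0.
  apply: eq_bigr => I hI.
  by rewrite rmorphM /= v_tau_u // linearZ /= tauK -scalerAl -scalerAr.
move=> /(uF _ (fun J => scaleG _ _ (tau_G_inv (cG J)))) /(_ J hJ).
move=> /(congr1 (fun a => tau (rev_sign t *: a))).
by rewrite scalerA rev_signK scale1r tauK scaler0 raddf0.
Qed.

Lemma v_comb c : \sum_(I | @Iadm n t I) c I *: v_ k I =
  tau (\sum_(I | @Iadm n t I) (c I * rev_sign t) *: u_ k I).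
Proof.
rewrite linear_sum; apply: eq_bigr => I hI.
by rewrite v_tau_u // scalerA [RHS]linearZ.
Qed.

End VCase.

(* k algebraically closed, n >= 2, 1 <= t <= n-1. Indices are 0-based:
   I : {set 'I_n} with @Iadm n t I means I subset {2..n} (1-based) with |I| = t. *)
Theorem theorem2p2 (k : closedFieldType) (n : nat) (Hn : (2 <= n)%N)
    (t : nat) (Ht : (1 <= t <= n.-1)%N) :
  (* (i) *)
  (module_basis (@G_inv k n) (@U_inv_wt k n (@lam_ n t)) (@Iadm n t) (@u_ k n) /\
   module_basis (@G_inv k n) (@U_inv_wt k n (@mu_ n t)) (@Iadm n t) (@v_ k n)) /\
  (* (ii) *)
  (forall c : {set 'I_n} -> k, (exists I, @Iadm n t I /\ c I != 0) ->
     let f := \sum_(I | @Iadm n t I) c I *: u_ k I in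
     irreducible_elt f /\ @B_semi_inv k n (@lam_ n t) f) /\
  (forall c : {set 'I_n} -> k, (exists I, @Iadm n t I /\ c I != 0) ->
     let f := \sum_(I | @Iadm n t I) c I *: v_ k I in
     irreducible_elt f /\ @B_semi_inv k n (@mu_ n t) f).
Proof.
case: n Hn Ht => // m Hn ht0; have ht : (0 < t < m.+1)%N := ht0.
split; first by split; [exact: u_module_basis | exact: v_module_basis].
split=> c c0 /=.
  by split; [exact: u_comb_irreducible | exact: u_comb_B_semi_inv].
rewrite v_comb //; pose c' I := c I * rev_sign k t.
have c'0 : exists I, @Iadm m.+1 t I /\ c' I != 0.
  case: c0 => I [hI cI]; exists I; split=> //.
  by rewrite mulf_neq0 // signr_eq0.
split; first exact/tau_irreducible/(u_comb_irreducible ht c'0).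
apply/B_semi_invE/(tau_weight (mu_lam ht))/B_semi_invE.
exact: (u_comb_B_semi_inv ht c').
Qed.
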